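(* Assume Schanuel's conjecture over the reals. Let $n\ge 1$, let $P\in\mathbb K[X_1,\dots,X_n,U_1,\dots,U_n]$ be such that the real algebraic set $\mathrm{Zer}(P)\subset\mathbb R^{2n}$ is irreducible (over $\mathbb K$), and let $f=E(P)$, i.e. $f(X_1,\dots,X_n)=P(X_1,\dots,X_n,e^{X_1},\dots,e^{X_n})$. Assume that the exponential set $\mathrm{Zer}(f)\subset\mathbb R^n$ has dimension $n-1$. Then either $\mathrm{Zer}(f)$ is irreducible, or every $(n-1)$-dimensional irreducible component of $\mathrm{Zer}(f)$ is a rational hyperplane through the origin (i.e. a set $\{m_1X_1+\cdots+m_nX_n=0\}$ with $m_1,\dots,m_n\in\mathbb Q$ not all zero).
   Context: $\mathbb K\subset\mathbb R$ is a fixed real algebraic extension of $\mathbb Q$. Write $\underline X=(X_1,\dots,X_n)$, $\underline U=(U_1,\dots,U_n)$, $e^{\underline X}=(e^{X_1},\dots,e^{X_n})$. $\mathbb K[\underline X,e^{\underline X}]$ is the ring of functions on $\mathbb R^n$ (E-polynomials) of the form $E(P):=P(\underline X,e^{\underline X})$ with $P\in\mathbb K[\underline X,\underline U]$. $\mathrm{Zer}(\cdot)$ denotes the common real zero set of the listed polynomials or E-polynomials. Real algebraic sets are zero sets of finitely many polynomials over $\mathbb K$; exponential sets are zero sets in $\mathbb R^n$ of finitely many E-polynomials. The exponential sets are the closed sets of a Noetherian (Zariski) topology on $\mathbb R^n$. A non-empty exponential (resp. algebraic) set is irreducible if it is not a union of two proper subsets which are themselves exponential (resp. algebraic over $\mathbb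 K$); every non-empty exponential set $V$ is uniquely a finite union of irreducible exponential sets, none contained in another, called its irreducible components. Dimension. For an exponential set $V\subset\mathbb R^n$ let $I(V)=(f_1,\dots,f_k)$ be the ideal of all E-polynomials vanishing on $V$ (it is finitely generated), let $\mathrm{rank}(V,\mathbf x)$ be the rank of the Jacobian matrix $\partial(f_1,\dots,f_k)/\partial(X_1,\dots,X_n)$ at $\mathbf x$, and $\mathrm{rank}\,I(V)=\sup_{\mathbf x\in V}\mathrm{rank}(V,\mathbf x)$ (independent of generators). If $V$ is irreducible, $\mathbf x\in V$ is regular if $\mathrm{rank}(V,\mathbf x)=\mathrm{rank}\,I(V)$. If $V$ is reducible, $\mathbf x\in V$ is regular if exactly one irreducible component of $V$ contains $\mathbf x$ and $\mathbf x$ is a regular point of that component. $\mathrm{Reg}(V)$ is the set of regular points, $\mathrm{Sing}(V)=V\setminus\mathrm{Reg}(V)$; $\mathrm{Sing}(V)$ is an exponential set properly contained in $V\neq\emptyset$. The non-singular stratification of $V$ is the finite partition $V=\mathrm{Reg}(V)\cup\mathrm{Reg}(\mathrm{Sing}(V))\cup\mathrm{Reg}(\mathrm{Sing}(\mathrm{Sing}(V)))\cup\cdots$ into real analytic manifolds, and $\dim V$ is the maximal dimension of these manifolds. Schanuel's conjecture over the reals: for every $N\ge 1$ and real numbers $x_1,\dots,x_N$, if the transcendence degree over $\mathbb Q$ of $x_1,\dots,x_N,e^{x_1},\dots,e^{x_N}$ is less than $N$, then there are integers $m_1,\dots,m_N$, not all zero, with $m_1x_1+\cdots+m_Nx_N=0$.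 *)

(* Defs.v *)
From HB Require Import structures.
From mathcomp Require Import all_boot all_order all_algebra.
From mathcomp Require Import all_classical all_reals all_analysis.
(* Only canonicals are imported: the notations of mpoly clash with those of analysis. *)
From mathcomp Require mpoly.
Import (canonicals) mpoly.

Set Implicit Arguments.
Unset Strict Implicit.
Unset Printing Implicit Defensive.

Import Order.TTheory GRing.Theory Num.Theory.
Import numFieldNormedType.Exports.
Local Open Scope classical_set_scope.
Local Open Scope ring_scope.

Definition real_algebraic_extension (R : realType) (K : {pred R}) : Prop :=
  GRing.divring_closed K /\
  (forall a : R, a \in K -> algebraicOver (ratr : rat -> R) a).

Definition poly_over (R : realType) (K : {pred R}) (m : nat)
    (P : mpoly.mpoly m R) : Prop :=
  P \is a mpoly.mpolyOver m K.

Definition peval (R : realType) (m : nat) (P : mpoly.mpoly m R)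
    (x : 'rV[R]_m) : R :=
  mpoly.meval (fun i => x 0 i) P.

(* The first n variables of P play the role of X, the last n that of U. *)
Definition E (R : realType) (n : nat) (P : mpoly.mpoly (n + n) R)
    (x : 'rV[R]_n) : R :=
  peval P (row_mx x (map_mx expR x)).

Definition Epolynomial (R : realType) (K : {pred R}) (n : nat) :
    set ('rV[R]_n -> R) :=
  [set f | exists2 P, poly_over K P & f = E P].

Definition Zer (R : realType) (T : Type) (k : nat) (f : 'I_k -> T -> R) :
    set T :=
  [set x | forall i, f i x = 0].

Definition Zer1 (R : realType) (T : Type) (f : T -> R) : set T :=
  [set x | f x = 0].

Definition algebraic_set (R : realType) (K : {pred R}) (m : nat) :
    set (set 'rV[R]_m) :=
  [set V | exists k (Q : 'I_k -> mpoly.mpoly m R),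
     (forall i, poly_over K (Q i)) /\ V = Zer (fun i => peval (Q i))].

Definition exponential_set (R : realType) (K : {pred R}) (n : nat) :
    set (set 'rV[R]_n) :=
  [set V | exists k (f : 'I_k -> 'rV[R]_n -> R),
     (forall i, Epolynomial K (f i)) /\ V = Zer f].

(* [F] is the family of the closed sets, algebraic or exponential. *)
Definition irreducible_set (T : Type) (F : set (set T)) (V : set T) : Prop :=
  [/\ F V, V !=set0 &
      ~ exists A B, [/\ F A, F B, A `<` V, B `<` V & V = A `|` B]].

Section Dimension.
Variables (R : realType) (K : {pred R}) (n : nat).
Implicit Types (V C M : set 'rV[R]_n) (x y : 'rV[R]_n).

Definition irreducible_decomposition V k (C : 'I_k -> set 'rV[R]_n) : Prop :=
  [/\ forall i, irreducible_set (exponential_set K (n := n)) (C i),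
      V = [set x | exists i, C i x] &
      forall i j, C i `<=` C j -> i = j].

Definition irreducible_component V C : Prop :=
  exists k (D : 'I_k -> set 'rV[R]_n),
    irreducible_decomposition V D /\ exists i, C = D i.

Definition vanishing_ideal V : set ('rV[R]_n -> R) :=
  [set f | Epolynomial K f /\ forall x, V x -> f x = 0].

Definition generates k (f : 'I_k -> 'rV[R]_n -> R)
    (I : set ('rV[R]_n -> R)) : Prop :=
  I = [set g | exists a : 'I_k -> 'rV[R]_n -> R,
         (forall i, Epolynomial K (a i)) /\
         g = fun x => \sum_(i < k) a i x * f i x].

Definition jacobian_matrix k (f : 'I_k -> 'rV[R]_n -> R) x : 'M[R]_(k, n) :=
  \matrix_(i < k, j < n) 'D_(delta_mx 0 j) (f i) x.

(* [vanishing_ideal V] is finitely generated, and for x in V the rank does not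
   depend on the generators, so that the set below is a singleton. *)
Definition rank_at V x : nat :=
  xget 0%N [set r | exists k (f : 'I_k -> 'rV[R]_n -> R),
    generates f (vanishing_ideal V) /\ r = \rank (jacobian_matrix f x)].

Definition rank_ideal V : nat :=
  \max_(r < n.+1 | `[< exists2 x, V x & rank_at V x = r >]) r.

Definition regular_point_irr V x : Prop :=
  V x /\ rank_at V x = rank_ideal V.

Definition Reg V : set 'rV[R]_n :=
  [set x |
    (irreducible_set (exponential_set K (n := n)) V /\ regular_point_irr V x) \/
    (~ irreducible_set (exponential_set K (n := n)) V /\
     exists C, [/\ irreducible_component V C, regular_point_irr C x &
       forall D, irreducible_component V D -> D x -> D = C])].

Definition Sing V : set 'rV[R]_n := V `\` Reg V.

Definition stratum V (i : nat) : set 'rV[R]_n := Reg (iter i Sing V).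

(* Power series centred at x, summed over the multi-indices of [0, N[^n. *)
Definition analytic_at (f : 'rV[R]_n -> R) x : Prop :=
  exists c : ('I_n -> nat) -> R,
    let term y (m : 'I_n -> nat) :=
      c m * \prod_(i < n) (y 0 i - x 0 i) ^+ m i in
    \forall y \near x,
      cvgn (fun N : nat =>
        \sum_(m : {ffun 'I_n -> 'I_N}) `|term y (fun i => m i)|) /\
      (fun N : nat => \sum_(m : {ffun 'I_n -> 'I_N}) term y (fun i => m i))
        @ \oo --> f y.

(* Near x, M is a real analytic submanifold of dimension d: the zero set of
   n - d analytic functions whose differentials at x are independent. *)
Definition submanifold_at M (d : nat) x : Prop :=
  (d <= n)%N /\ M x /\
  exists (U : set 'rV[R]_n) (g : 'I_(n - d) -> 'rV[R]_n -> R),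
    [/\ open U, U x,
        forall i y, U y -> analytic_at (g i) y,
        M `&` U = Zer g `&` U &
        \rank (jacobian_matrix g x) = (n - d)%N].

(* The strata need not be equidimensional. No d qualifies if V is empty. *)
Definition has_dim V (d : nat) : Prop :=
  (exists i x, submanifold_at (stratum V i) d x) /\
  (forall i x e, submanifold_at (stratum V i) e x -> (e <= d)%N).

End Dimension.

Definition rational_hyperplane (R : realType) (n : nat) (H : set 'rV[R]_n) :
    Prop :=
  exists m : 'I_n -> rat,
    (exists i, m i != 0) /\ H = [set x | \sum_(i < n) ratr (m i) * x 0 i = 0].

Definition algebraically_independent (R : realType) (k : nat)
    (y : 'I_k -> R) : Prop :=
  forall p : mpoly.mpoly k rat, mpoly.mmap (ratr : rat -> R) y p = 0 -> p = 0.

Definition trdeg (R : realType) (k : nat) (y : 'I_k -> R) : nat :=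
  \max_(S : {set 'I_k} |
        `[< algebraically_independent (fun i : 'I_#|S| => y (enum_val i)) >])
    #|S|.

Definition Schanuel_conjecture (R : realType) : Prop :=
  forall (N : nat) (x : 'rV[R]_N), (1 <= N)%N ->
    (trdeg (fun i => (row_mx x (map_mx expR x) 0 i)%R) < N)%N ->
    exists m : 'I_N -> int,
      (exists i, m i != 0) /\ \sum_(i < N) (m i)%:~R * x 0 i = 0.

(* Main.v *)
(* Let V = Zer(f), let C be an irreducible component of V of dimension n - 1, and
   let I be the prime ideal of the polynomials F with E(F) = 0 on C. It contains the
   prime ideal J of Zer(P).

   Fix one of the 2n variables. If I contains no nonzero polynomial free of that
   variable, then over the fraction field of the other 2n - 1 variables I and J
   become nonzero primes of a principal ideal domain, so I = J and C = V. Hence if V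
   is reducible, then for every variable k there is a relation R_k <> 0 in I that
   does not involve it.

   Since C contains a manifold of dimension n - 1, for some j it meets every line
   parallel to the j-th axis above an open set U of the other coordinates x'. Let
   (x', t) be in C. If the x_i are algebraic and independent over Q, Schanuel's
   conjecture and the relations R_k yield t = q.x' with q rational, and R_(u_j)
   then vanishes at (x', t) identically in the exponentials. Such x' are dense in U,
   so by compactness a fixed nonzero polynomial r(x', t) vanishes at some point of C
   above each x' in U. If instead the x_i are rational multiples of logarithms of
   primes, again t = q.x', but now x' is algebraically independent, and
   r(x', q.x') = 0 holds identically; this leaves finitely many q. By density one q
   works above an open set, and C contains the hyperplane H = {x_j = q.x'} by the
   identity theorem for exponential polynomials.

   Finally, among the polynomials free of u_j, the ideals of C and of H are primes,
   the first is nonzero and contained in the second, and no nonzero element of the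
   second is free of x_j. By the argument that gave I = J they coincide, so
   x_j - q.x' vanishes on C and C = H. *)

Require Import Defs.
From HB Require Import structures.
From mathcomp Require Import all_boot all_order all_algebra.
From mathcomp Require Import all_classical all_reals all_analysis.
From mathcomp Require Import ring lra.
From mathcomp Require Import -(notations) mpoly.

Set Implicit Arguments.
Unset Strict Implicit.
Unset Printing Implicit Defensive.

Import Order.TTheory GRing.Theory Num.Theory.
Import numFieldNormedType.Exports.
Local Open Scope classical_set_scope.
Local Open Scope ring_scope.

(** * Substitution morphisms on multivariate polynomials *)

Local Notation mvar i := (@mpolyX _ _ (@mnm1 _ i)).

(** A morphism out of a polynomial ring is determined by its values on constants and variables.
    Rewriting one or both sides with it reduces an identity between substitutions to these two
    cases. *)
Lemma mmap_rmorphE n (A : comNzRingType) (B : comNzRingType)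
    (phi : {rmorphism mpoly n A -> B}) (P : mpoly n A) :
  phi P = mmap (phi \o @mpolyC n A) (fun i => phi (mvar i)) P.
Proof.
rewrite [in LHS](mpolyE P) raddf_sum; apply: eq_bigr => m _ /=.
rewrite -mul_mpolyC rmorphM; congr (_ * _).
by rewrite mpolyXE_id rmorph_prod; apply: eq_bigr => i _; rewrite rmorphXn.
Qed.

Lemma eq_mmap n (A B : comNzRingType) (f g : A -> B) (h k : 'I_n -> B) P :
  f =1 g -> h =1 k -> mmap f h P = mmap g k P.
Proof.
move=> fg hk; apply: eq_bigr => m _; rewrite fg; congr (_ * _).
exact: mmap1_eq.
Qed.

Lemma mmapXU n (A B : comNzRingType) (f : {rmorphism A -> B}) (h : 'I_n -> B) i :
  mmap f h (mvar i) = h i.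
Proof. by rewrite mmapX mmap1U. Qed.

Lemma mmap_comp n m (A B : comNzRingType) (f : {rmorphism A -> B})
    (z : 'I_m -> B) (h : 'I_n -> mpoly m A) P :
  mmap f z (mmap (@mpolyC m A) h P) = mmap f (fun i => mmap f z (h i)) P.
Proof.
rewrite [LHS](mmap_rmorphE (mmap f z \o mmap (@mpolyC m A) h)).
by apply: eq_mmap => [c|i] /=; rewrite ?mmapC ?mmapXU.
Qed.

Lemma meval_map_mpoly n (A B : comNzRingType) (f : {rmorphism A -> B})
    (v : 'I_n -> B) P :
  meval v (map_mpoly f P) = mmap f v P.
Proof.
rewrite [LHS](mmap_rmorphE (meval v \o map_mpoly f)).
by apply: eq_mmap => [c|i] /=; rewrite ?map_mpolyC ?map_mpolyX ?mevalC ?mevalXU.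
Qed.

Lemma mmap_map_mpoly n (A B C : comNzRingType) (f : {rmorphism A -> B})
    (g : {rmorphism B -> C}) (z : 'I_n -> C) P :
  mmap g z (map_mpoly f P) = mmap (g \o f) z P.
Proof.
rewrite [LHS](mmap_rmorphE (mmap g z \o map_mpoly f)).
by apply: eq_mmap => [c|i] /=; rewrite ?map_mpolyC ?map_mpolyX ?mmapC ?mmapXU.
Qed.

Lemma mmap_linear_form n (A B : comNzRingType) (f : {rmorphism A -> B})
    (z : 'I_n -> B) (I : finType) (P : pred I) (a : I -> A) (g : I -> 'I_n) :
  mmap f z (\sum_(k | P k) mpolyC n (a k) * mvar (g k)) =
  \sum_(k | P k) f (a k) * z (g k).
Proof.
rewrite rmorph_sum; apply: eq_bigr => k _.
by rewrite rmorphM /= mmapC mmapXU.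
Qed.

Lemma mmap_sub n (A B : comNzRingType) (f : {rmorphism A -> B}) (z : 'I_n -> B) F G :
  mmap f z (F - G) = mmap f z F - mmap f z G.
Proof. exact: rmorphB. Qed.

(** * Splitting off one variable *)

Section SplitVariable.
Variables (A : comNzRingType) (N : nat) (k : 'I_N).

(** A polynomial free of the k-th variable is encoded as an element of [mpoly N.-1 A], whose i-th
    variable stands for the variable [lift k i]. *)
Definition mpoly_rename : mpoly N.-1 A -> mpoly N A :=
  mmap (@mpolyC N A) (fun i => mvar (lift k i)).

HB.instance Definition _ := GRing.RMorphism.copy mpoly_rename
  (mmap (@mpolyC N A) (fun i => mvar (lift k i))).

Let poly_var (i : 'I_N) : {poly mpoly N.-1 A} :=
  if unlift k i is Some j then (mvar j)%:P else 'X.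

Definition poly_of_mpoly : mpoly N A -> {poly mpoly N.-1 A} :=
  mmap (polyC \o @mpolyC N.-1 A) poly_var.

HB.instance Definition _ := GRing.RMorphism.copy poly_of_mpoly
  (mmap (polyC \o @mpolyC N.-1 A) poly_var).

Definition mpoly_of_poly : {poly mpoly N.-1 A} -> mpoly N A :=
  horner_eval (mvar k) \o map_poly mpoly_rename.

HB.instance Definition _ := GRing.RMorphism.copy mpoly_of_poly
  (horner_eval (mvar k) \o map_poly mpoly_rename).

Lemma mpoly_of_polyC c : mpoly_of_poly c%:P = mpoly_rename c.
Proof. by rewrite /mpoly_of_poly /= map_polyC /horner_eval hornerC. Qed.

Lemma mpoly_of_polyX : mpoly_of_poly 'X = mvar k.
Proof. by rewrite /mpoly_of_poly /= map_polyX /horner_eval hornerX. Qed.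

Lemma poly_of_mpolyX : poly_of_mpoly (mvar k) = 'X.
Proof. by rewrite /poly_of_mpoly mmapXU /poly_var unlift_none. Qed.

Lemma poly_of_mpoly_rename s : poly_of_mpoly (mpoly_rename s) = s%:P.
Proof.
rewrite [LHS](mmap_rmorphE (poly_of_mpoly \o mpoly_rename)).
rewrite [RHS](mmap_rmorphE (@polyC (mpoly N.-1 A))).
apply: eq_mmap => [c|i] /=.
  by rewrite /mpoly_rename mmapC /poly_of_mpoly mmapC.
by rewrite /mpoly_rename mmapXU /poly_of_mpoly mmapXU /poly_var liftK.
Qed.

Lemma poly_of_mpolyK : cancel poly_of_mpoly mpoly_of_poly.
Proof.
move=> P; rewrite [LHS](mmap_rmorphE (mpoly_of_poly \o poly_of_mpoly)).
rewrite [RHS](mmap_rmorphE (@idfun (mpoly N A))).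
apply: eq_mmap => [c|i] /=.
  by rewrite /poly_of_mpoly mmapC /= mpoly_of_polyC /mpoly_rename mmapC.
rewrite /poly_of_mpoly mmapXU /poly_var; case: unliftP => [j ->|->].
  by rewrite mpoly_of_polyC /mpoly_rename mmapXU.
exact: mpoly_of_polyX.
Qed.

Lemma mpoly_of_polyK : cancel mpoly_of_poly poly_of_mpoly.
Proof.
elim/poly_ind => [|p c IHp]; first by rewrite !rmorph0.
rewrite 2!rmorphD 2!rmorphM /= IHp mpoly_of_polyX poly_of_mpolyX.
by rewrite mpoly_of_polyC poly_of_mpoly_rename.
Qed.

Lemma mpoly_rename_inj : injective mpoly_rename.
Proof.
move=> s t st; apply: (@polyC_inj (mpoly N.-1 A)).
by rewrite -!poly_of_mpoly_rename st.
Qed.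

Lemma mmap_rename (B : comNzRingType) (f : {rmorphism A -> B}) (z : 'I_N -> B) s :
  mmap f z (mpoly_rename s) = mmap f (z \o lift k) s.
Proof.
rewrite [LHS](mmap_rmorphE (mmap f z \o mpoly_rename)).
by apply: eq_mmap => [c|i] /=; rewrite /mpoly_rename ?mmapC ?mmapXU.
Qed.

(** The other variables are evaluated first, which turns a polynomial in N variables into one in the
    k-th variable alone. *)
Lemma horner_poly_of_mpoly (B : comNzRingType) (f : {rmorphism A -> B})
    (z : 'I_N -> B) P :
  (map_poly (mmap f (z \o lift k)) (poly_of_mpoly P)).[z k] = mmap f z P.
Proof.
rewrite -[in RHS](poly_of_mpolyK P); move: (poly_of_mpoly P).
elim/poly_ind => [|p c IHp]; first by rewrite !rmorph0 horner0.
rewrite rmorphD rmorphM /= map_polyX map_polyC hornerMXaddC IHp.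
rewrite 2!rmorphD 2!rmorphM /= mpoly_of_polyX mmapXU mpoly_of_polyC.
by rewrite mmap_rename.
Qed.

End SplitVariable.

(** * Points with positive integer coordinates outside a hypersurface *)

Lemma mpoly0_eqC (A : comNzRingType) (P : mpoly 0 A) : P = mpolyC 0 (mcoeff mnm0 P).
Proof.
apply/mpolyP => m; rewrite mcoeffC.
have -> : m = mnm0 by apply/mnmP => -[].
by rewrite eqxx mulr1.
Qed.

Lemma poly_nonzero_nat (F : numFieldType) (p : {poly F}) :
  p != 0 -> exists m : nat, p.[m.+1%:R] != 0.
Proof.
move=> p0; apply: contrapT => H.
pose s := [seq m.+1%:R : F | m <- iota 0 (size p)].
have : (size s < size p)%N.
  apply: max_poly_roots => //.
    apply/allP => _ /mapP[m _ ->]; apply/rootP; apply: contrapT => /eqP pm.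
    by apply: H; exists m.
  rewrite map_inj_uniq ?iota_uniq // => a b /eqP.
  by rewrite eqr_nat => /eqP[].
by rewrite size_map size_iota ltnn.
Qed.

(** By induction, the leading coefficient in the first variable is made nonzero, then the first
    variable is chosen. Positive integers are both algebraic numbers and exponentials of reals; each
    property serves later. *)
Lemma mpoly_nonzero_point N (A : comNzRingType) (F : numFieldType)
    (f : {rmorphism A -> F}) (P : mpoly N A) : injective f -> P != 0 ->
  exists w : 'I_N -> nat, mmap f (fun i => (w i).+1%:R) P != 0.
Proof.
move=> f_inj; elim: N P => [|N IHN] P P0.
  exists (fun=> 0%N); apply: contraNneq P0.
  by rewrite [in mmap _ _ P](mpoly0_eqC P) mmapC [in P == _](mpoly0_eqC P)
    -(rmorph0 f) => /f_inj ->.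
have : poly_of_mpoly ord0 P != 0.
  by apply: contraNneq P0 => PE; rewrite -(poly_of_mpolyK ord0 P) PE rmorph0.
rewrite -lead_coef_eq0 => /(IHN _)[w ww].
set q := poly_of_mpoly _ _ in ww.
have : map_poly (mmap f (fun i => (w i).+1%:R)) q != 0.
  apply: contraNneq ww => /polyP/(_ (size q).-1).
  by rewrite coef_map coef0 lead_coefE => ->.
case/poly_nonzero_nat => m qm.
exists (fun i => if unlift ord0 i is Some j then w j else m).
rewrite -(horner_poly_of_mpoly ord0) unlift_none.
have -> // : map_poly (mmap f ((fun i => (if unlift ord0 i is Some j then w j
    else m).+1%:R) \o lift ord0)) q = map_poly (mmap f (fun i => (w i).+1%:R)) q.
by apply: eq_map_poly => c; apply: eq_mmap => // i /=; rewrite liftK.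
Qed.

(** * Ideals, and primes of polynomial rings over a domain *)

Record ideal (A : comNzRingType) (I : A -> Prop) : Prop := Ideal {
  ideal0 : I 0;
  idealB : forall a b, I a -> I b -> I (a - b);
  idealM : forall a b, I b -> I (a * b) }.

Definition prime_ideal (A : comNzRingType) (I : A -> Prop) : Prop :=
  ideal I /\ forall a b, I (a * b) -> I a \/ I b.

(* Over the fraction field of S, I and J become nonzero primes of a principal
   ideal domain. *)
Lemma prime_ideal_poly_eq (S : idomainType) (I J : {poly S} -> Prop) :
  ideal I -> prime_ideal J -> (forall p, J p -> I p) ->
  (forall s, I s%:P -> s = 0) -> (exists2 p, p != 0 & J p) ->
  forall p, I p -> J p.
Proof.
move=> iI [iJ pJ] JI I0 nzJ.
have minimal (K : {poly S} -> Prop) : (exists2 p, p != 0 & K p) ->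
    exists q, [/\ q != 0, K q & forall p, p != 0 -> K p -> (size q <= size p)%N].
  case=> p0 p0n Kp0.
  pose has_size d := `[< exists p, [/\ p != 0, K p & size p = d] >].
  have ex : exists d, has_size d by exists (size p0); apply/asboolP; exists p0.
  case: (ex_minnP ex) => d /asboolP[q [qn Kq <-]] minq.
  by exists q; split=> // p pn Kp; apply: minq; apply/asboolP; exists p.
have [Q [Qn JQ minQ]] := minimal J nzJ.
have [T [Tn IT minT]] : exists q,
    [/\ q != 0, I q & forall p, p != 0 -> I p -> (size q <= size p)%N].
  by apply: minimal; case: nzJ => p pn /JI; exists p.
(* T has least size in I, and the remainder of a pseudo-division by T lies in I, so it is 0. *)
have divT p : I p -> exists2 c, c != 0 & exists a, c *: p = a * T.
  move=> Ip; have E := Pdiv.Idomain.divp_eq p T.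
  exists (lead_coef T ^+ scalp p T); first by rewrite expf_neq0 ?lead_coef_eq0.
  exists (p %/ T); rewrite E [X in _ + X = _](_ : _ = 0) ?addr0 //.
  apply: contrapT => /eqP modn0.
  have := Pdiv.Idomain.ltn_modpN0 p Tn; rewrite ltnNge minT //.
  have -> : p %% T = lead_coef T ^+ scalp p T *: p - p %/ T * T.
    by rewrite E addrAC subrr add0r.
  by rewrite -mul_polyC; apply: (idealB iI); apply: (idealM iI).
(* Write c Q = a T, with Q of least size in J. If a were in J, comparing sizes would make T a
   constant of I, hence 0. *)
have JT : J T.
  have [c cn [a aE]] := divT Q (JI _ JQ).
  have JaT : J (a * T) by rewrite -aE -mul_polyC; apply: (idealM iJ).
  case: (pJ _ _ JaT) => // Ja.
  have an : a != 0.
    apply: contraNneq Qn => a0; move: aE; rewrite a0 mul0r => /eqP.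
    by rewrite scale_poly_eq0 (negPf cn).
  have := minQ a an Ja; rewrite -(size_scale _ cn) aE size_mul //.
  rewrite -subn1 leq_subLR addnC leq_add2r => sT.
  by move: Tn IT; rewrite (size1_polyC sT) => + /I0 T0; rewrite T0 eqxx.
move=> p Ip; have [c cn [a aE]] := divT p Ip.
have : J (c%:P * p) by rewrite mul_polyC aE; apply: (idealM iJ).
by case/pJ => // /JI/I0 c0; rewrite c0 eqxx in cn.
Qed.

(** * Algebraic independence over the real algebraic numbers *)

Section Subfield.
Variables (F : fieldType) (K : {pred F}) (hK : GRing.divring_closed K).

(** The closure hypothesis is an argument so that the instances below can be attached to an
    arbitrary such K. *)
Definition divring_pred of GRing.divring_closed K := K.

HB.instance Definition _ := GRing.isDivringClosed.Build F (divring_pred hK) hK.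

Record subfield := Subfield {
  subfield_val : F;
  subfield_valP : subfield_val \in divring_pred hK }.

HB.instance Definition _ := [isSub for subfield_val].
HB.instance Definition _ := [Choice of subfield by <:].
HB.instance Definition _ := [SubChoice_isSubIntegralDomain of subfield by <:].
HB.instance Definition _ := [SubIntegralDomain_isSubField of subfield by <:].

Lemma subfield_val_inj : injective (\val : subfield -> F).
Proof. exact: val_inj. Qed.

Variables (A : comNzRingType) (f : {rmorphism A -> F}) (fK : forall a, f a \in K).

Definition subfield_corestr (a : A) : subfield := @Subfield (f a) (fK a).

Lemma subfield_corestr_zmod : zmod_morphism subfield_corestr.
Proof. by move=> a b; apply: val_inj; rewrite /= rmorphB. Qed.

Lemma subfield_corestr_monoid : monoid_morphism subfield_corestr.
Proof.
by split=> [|a b]; apply: val_inj; rewrite /= ?rmorph1 ?rmorphM.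
Qed.

HB.instance Definition _ :=
  GRing.isZmodMorphism.Build A subfield subfield_corestr subfield_corestr_zmod.
HB.instance Definition _ :=
  GRing.isMonoidMorphism.Build A subfield subfield_corestr subfield_corestr_monoid.

End Subfield.

Lemma integral_mmap n (A : comNzRingType) (F E : fieldType)
    (FtoE : {rmorphism F -> E}) (f : A -> E) (z : 'I_n -> E) P :
  (forall a, integralOver FtoE (f a)) -> (forall i, integralOver FtoE (z i)) ->
  integralOver FtoE (mmap f z P).
Proof.
move=> hf hz; apply: (big_ind (integralOver FtoE)) => [||m _].
- exact: mxpoly.integral0.
- exact: mxpoly.integral_add.
apply: mxpoly.integral_mul => //; apply: (big_ind (integralOver FtoE)) => [||j _].
- exact: mxpoly.integral1.
- exact: mxpoly.integral_mul.
elim: (m j) => [|e IHe]; first by rewrite expr0; apply: mxpoly.integral1.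
by rewrite exprS; apply: mxpoly.integral_mul.
Qed.

Section AlgebraicIndependence.
Variable R : realType.

Lemma real_alg_closed :
  GRing.divring_closed [pred a : R | `[< algebraicOver (ratr : rat -> R) a >]].
Proof.
split=> [|a b /asboolP ha /asboolP hb|a b /asboolP ha /asboolP hb];
  apply/asboolP.
- exact: algebraic1.
- exact: algebraic_sub.
- exact: algebraic_div.
Qed.

Definition real_alg := subfield real_alg_closed.

Lemma real_algP (a : real_alg) : algebraicOver (ratr : rat -> R) (\val a).
Proof. by have /asboolP := subfield_valP a. Qed.

Lemma real_algE (x : R) : algebraicOver (ratr : rat -> R) x ->
  \val (insubd 0 x : real_alg) = x.
Proof. by move=> hx; rewrite insubdK //; apply/asboolP. Qed.

Section RationalFunctions.
Variables (k : nat) (y : 'I_k -> R).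
Local Notation ev := (mmap (ratr : rat -> R) y).

Lemma ratfun_closed : GRing.divring_closed
  [pred z : R | `[< exists a b, ev b != 0 /\ z = ev a / ev b >]].
Proof.
split=> [|x z /asboolP[a [b [b0 ->]]] /asboolP[c [d [d0 ->]]]|
          x z /asboolP[a [b [b0 ->]]] /asboolP[c [d [d0 ->]]]]; apply/asboolP.
- by exists 1, 1; rewrite rmorph1 divr1 oner_eq0.
- exists (a * d - c * b), (b * d); rewrite rmorphB !rmorphM /= mulf_neq0 //.
  by split=> //; field; rewrite b0 d0.
(* Closure under division includes division by 0, whose value is 0. *)
- have [c0|c0] := eqVneq (ev c) 0.
    by exists 0, 1; rewrite rmorph0 rmorph1 oner_eq0 c0 !(mul0r, invr0, mulr0).
  exists (a * d), (b * c); rewrite !rmorphM /= mulf_neq0 //.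
  by split=> //; field; rewrite b0 d0 c0.
Qed.

Definition ratfun := subfield ratfun_closed.

(** A common denominator of the coefficients turns an algebraic equation over Q(y) into a polynomial
    relation over Q. *)
Lemma ratfun_clear (p : {poly ratfun}) : exists b (q : {poly mpoly k rat}),
  ev b != 0 /\ map_poly ev q = ev b *: map_poly \val p.
Proof.
elim/poly_ind: p => [|p c [b [q [b0 qE]]]].
  by exists 1, 0; rewrite !rmorph0 rmorph1 scaler0 oner_eq0.
have [n [d [d0 cE]]] : exists a b, ev b != 0 /\ \val c = ev a / ev b.
  by have /asboolP := subfield_valP c.
exists (b * d), (d *: q * 'X + (b * n)%:P); split.
  by rewrite rmorphM mulf_neq0.
apply/polyP => i; rewrite coefZ !coef_map /= !coefD !coefMX !coefC coefZ.
have /polyP/(_ i.-1) := qE; rewrite coefZ !coef_map => qi.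
case: i qi => [|i] /= qi; rewrite ?addr0 ?add0r.
  by rewrite !rmorphM /= cE; field.
by rewrite !rmorphM /= qi; ring.
Qed.

End RationalFunctions.

Lemma algebraically_independent_lift k (y : 'I_k -> R) i :
  algebraically_independent y -> algebraically_independent (y \o lift i).
Proof.
move=> hy p p0; apply: (@mpoly_rename_inj _ _ i); rewrite rmorph0.
by apply: hy; rewrite mmap_rename.
Qed.

Lemma algebraic_ratfun k (y : 'I_k -> R) z : algebraicOver (ratr : rat -> R) z ->
  algebraicOver (\val : ratfun y -> R) z.
Proof.
have ratrK a : ratr a \in [pred z : R | `[< exists n d,
    mmap (ratr : rat -> R) y d != 0 /\
    z = mmap (ratr : rat -> R) y n / mmap (ratr : rat -> R) y d >]].
  apply/asboolP; exists (mpolyC _ a), 1.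
  by rewrite rmorph1 divr1 oner_eq0 mmapC.
case=> p p0 pz; exists (map_poly (subfield_corestr (ratfun_closed y) ratrK) p).
  by rewrite map_poly_eq0.
by rewrite -map_poly_comp.
Qed.

(** By induction on k: a nonzero relation makes the first coordinate algebraic over Q(y'), where y'
    collects the other coordinates, because real algebraic coefficients are algebraic over Q(y').
    Clearing denominators gives a rational relation. *)
Lemma algebraically_independent_real_alg k (y : 'I_k -> R)
    (G : mpoly k real_alg) :
  algebraically_independent y -> mmap \val y G = 0 -> G = 0.
Proof.
elim: k y G => [|k IHk] y G hy.
  rewrite [G]mpoly0_eqC mmapC => G0; congr mpolyC.
  by apply: val_inj; rewrite G0 rmorph0.
move=> Gy; apply: contrapT => /eqP G0.
have hy' := algebraically_independent_lift (i := ord0) hy.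
set y' := y \o lift ord0 in hy'.
set q := poly_of_mpoly ord0 G.
have q0 : q != 0.
  by apply: contraNneq G0 => q0; rewrite -(poly_of_mpolyK ord0 G) -/q q0 rmorph0.
pose g := map_poly (mmap \val y') q.
have g0 : g != 0.
  apply: contraNneq q0 => /polyP/(_ (size q).-1); rewrite coef_map coef0.
  by move=> /(IHk _ _ hy')/eqP; rewrite -lead_coefE lead_coef_eq0.
have gy : root g (y ord0) by rewrite /root horner_poly_of_mpoly Gy.
have [p p0 py] : algebraicOver (\val : ratfun y' -> R) (y ord0).
  apply/integral_algebraic; apply: (mxpoly.integral_root g0 gy) => z.
  move=> /(nthP 0)[i _ <-]; rewrite coef_map.
  apply: integral_mmap => [a|j].
    by apply/integral_algebraic/algebraic_ratfun/real_algP.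
  have hyj : y' j \in divring_pred (ratfun_closed y').
    apply/asboolP; exists (mvar j), 1.
    by rewrite rmorph1 divr1 oner_eq0 mmapXU.
  exact: (integral_id \val (Subfield hyj)).
have [b [r [b0 rE]]] := ratfun_clear p.
have r0 : r = 0.
  apply: (can_inj (mpoly_of_polyK ord0)); rewrite [RHS]rmorph0.
  apply: hy; rewrite -(horner_poly_of_mpoly ord0) mpoly_of_polyK -/y' rE.
  by rewrite hornerZ (rootP py) mulr0.
move: rE; rewrite r0 rmorph0 => /esym/eqP.
by rewrite scale_poly_eq0 (negPf b0) map_poly_eq0 (negPf p0).
Qed.

(** Once the coordinates outside S are treated as constants, s becomes a polynomial in independent
    numbers over the real algebraic numbers; its vanishing there makes it the zero polynomial. *)
Lemma algebraic_relation_specialize N (y : 'I_N -> R) (S : {set 'I_N})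
    (s : mpoly N real_alg) :
  algebraically_independent (fun i : 'I_#|S| => y (enum_val i)) ->
  (forall i, i \notin S -> algebraicOver (ratr : rat -> R) (y i)) ->
  mmap \val y s = 0 ->
  forall w, (forall i, i \notin S -> w i = y i) -> mmap \val w s = 0.
Proof.
move=> hS hy sy w hw.
pose h i : mpoly #|S| real_alg :=
  if [pick j | enum_val j == i] is Some j then mvar j
  else mpolyC _ (insubd 0 (y i)).
have hE z : (forall i, i \notin S -> z i = y i) ->
    mmap \val (fun i => z (enum_val i)) (mmap (@mpolyC _ _) h s) = mmap \val z s.
  move=> hz; rewrite mmap_comp; apply: eq_mmap => // i; rewrite /h.
  case: pickP => [j /eqP <-|nj]; first by rewrite mmapXU.
  have iS : i \notin S.
    apply/negP => iS; have := nj (enum_rank_in iS i).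
    by rewrite enum_rankK_in // eqxx.
  by rewrite mmapC /= real_algE ?hz //; apply: hy.
have s0 : mmap (@mpolyC _ _) h s = 0.
  by apply: (algebraically_independent_real_alg hS); rewrite hE.
by rewrite -hE // s0 rmorph0.
Qed.

End AlgebraicIndependence.

(** * Consequences of Schanuel's conjecture *)

Section Schanuel.
Variable R : realType.
Local Notation algebraic := (algebraicOver (ratr : rat -> R)).

Lemma algebraically_independent_transcendental k (y : 'I_k -> R) i :
  algebraically_independent y -> ~ algebraic (y i).
Proof.
move=> hy [p p0 py].
pose q := map_poly (@mpolyC k.-1 rat) p.
have : mpoly_of_poly i q = 0.
  apply: hy; rewrite -(horner_poly_of_mpoly i) mpoly_of_polyK -map_poly_comp.
  rewrite (eq_map_poly (g := ratr)) => [|a /=]; first exact: (rootP py).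
  by rewrite mmapC.
rewrite -[RHS](rmorph0 (mpoly_of_poly i)) => /(can_inj (mpoly_of_polyK i)) q0.
case/negP: p0; apply/eqP/polyP => j; apply/eqP; rewrite coef0.
by move/polyP/(_ j)/eqP: q0; rewrite coef_map coef0 mpolyC_eq0.
Qed.

Definition exp_graph n (x : 'rV[R]_n) (i : 'I_(n + n)) : R :=
  row_mx x (map_mx expR x) 0 i.

Definition int_free n (x : 'rV[R]_n) : Prop :=
  forall m : 'I_n -> int, \sum_(i < n) (m i)%:~R * x 0 i = 0 -> forall i, m i = 0.

Hypothesis hS : Schanuel_conjecture R.

(** Contrapositive of the conjecture, with [trdeg] replaced by an independent subfamily. *)
Lemma schanuel_independent n (x : 'rV[R]_n) : (0 < n)%N -> int_free x ->
  exists2 S : {set 'I_(n + n)}, (n <= #|S|)%N &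
    algebraically_independent (fun i : 'I_#|S| => exp_graph x (enum_val i)).
Proof.
move=> n0 hx; apply: contrapT => noS.
have [|m [[i mi] mx]] := hS (x := x) n0; last by rewrite hx ?eqxx in mi.
have pred_n m : (m < n)%N = (m <= n.-1)%N by rewrite -[in LHS](prednK n0).
rewrite pred_n; apply/bigmax_leqP => S /asboolP indS; rewrite -pred_n.
by rewrite ltnNge; apply/negP => nS; apply: noS; exists S.
Qed.

Lemma independent_disjoint_algebraic k (y : 'I_k -> R) (S D : {set 'I_k}) :
  algebraically_independent (fun i : 'I_#|S| => y (enum_val i)) ->
  (forall i, i \in D -> algebraic (y i)) -> S \subset ~: D.
Proof.
move=> indS algD; apply/fintype.subsetP => i iS; rewrite inE; apply/negP => /algD.
rewrite -[i in y i](enum_rankK_in iS iS).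
exact: (algebraically_independent_transcendental (i := enum_rank_in iS i) indS).
Qed.

(** The conjecture yields at least n independent numbers among the 2n; none is in D and at most n
    lie outside, so the complement of D is independent. On D, y may differ from (x, e^x), provided
    that it stays algebraic. *)
Lemma schanuel_specialize n (x : 'rV[R]_n) (D : {set 'I_(n + n)}) :
  (0 < n)%N -> int_free x -> (#|~: D| <= n)%N ->
  (forall i, i \in D -> algebraic (exp_graph x i)) ->
  forall y, (forall i, i \notin D -> y i = exp_graph x i) ->
  (forall i, i \in D -> algebraic (y i)) ->
  forall s : mpoly (n + n) (real_alg R), mmap \val y s = 0 ->
  forall w, (forall i, i \in D -> w i = y i) -> mmap \val w s = 0.
Proof.
move=> n0 hx cardD algD y yx algy s sy w wy.
have [S nS indS] := schanuel_independent n0 hx.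
have /eqP SD : S == ~: D.
  by rewrite eqEcard (independent_disjoint_algebraic indS algD) (leq_trans cardD).
apply: (algebraic_relation_specialize (S := S) _ _ sy) => [|i|i].
- congr algebraically_independent: indS; apply/funext => i; rewrite yx //.
  by have := enum_valP i; rewrite [in X in _ \in X]SD inE.
- by rewrite SD inE negbK; apply: algy.
- by rewrite SD inE negbK; apply: wy.
Qed.

Lemma algebraic_relation_specialize_lift N (y : 'I_N -> R) (S : {set 'I_N}) k
    (s : mpoly N.-1 (real_alg R)) :
  algebraically_independent (fun i : 'I_#|S| => y (enum_val i)) ->
  (forall i, i \notin S -> i != k -> algebraic (y i)) ->
  mmap \val (y \o lift k) s = 0 ->
  forall w, (forall i, i \notin S -> i != k -> w i = y i) ->
  mmap \val (w \o lift k) s = 0.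
Proof.
move=> indS algy sy w wy.
(* The k-th coordinate may be transcendental. Outside S it is set to 0, which does not affect s. *)
pose reset (z : 'I_N -> R) i := if (i == k) && (i \notin S) then 0 else z i.
have resetE z : mmap \val (reset z) (mpoly_rename k s) = mmap \val (z \o lift k) s.
  rewrite mmap_rename; apply: eq_mmap => // i /=.
  by rewrite /reset eq_sym (negPf (neq_lift _ _)).
rewrite -resetE; apply: (algebraic_relation_specialize (y := reset y) (S := S)).
- congr algebraically_independent: indS; apply/funext => i.
  by rewrite /reset enum_valP andbF.
- move=> i iS; rewrite /reset iS andbT.
  by have [_|ik] := eqVneq i k; [exact: algebraic0|exact: algy].
- by rewrite resetE.
- move=> i iS; rewrite /reset iS andbT.
  by have [_|ik] := eqVneq i k; [|exact: wy].
Qed.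

(* If the z_i were independent over Q, Schanuel's conjecture would make all but at
   most one, say the k-th, of the n + 1 numbers outside D independent; [r k], which
   does not involve the k-th one, would then vanish identically in the others. *)
Lemma schanuel_relation n (z : 'rV[R]_n) (D : {set 'I_(n + n)})
    (r : 'I_(n + n) -> mpoly (n + n).-1 (real_alg R)) w :
  (0 < n)%N -> (#|~: D| <= n.+1)%N ->
  (forall i, i \in D -> algebraic (exp_graph z i)) ->
  (forall k, mmap \val (exp_graph z \o lift k) (r k) = 0) ->
  (forall i, i \in D -> w i = exp_graph z i) ->
  (forall k, mmap \val (w \o lift k) (r k) != 0) ->
  exists m : 'I_n -> int,
    (exists i, m i != 0) /\ \sum_(i < n) (m i)%:~R * z 0 i = 0.
Proof.
move=> n0 cardD algD rz wz rw; apply: contrapT => norel.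
have hz : int_free z.
  move=> m mz i; apply: contrapT => /eqP mi; apply: norel.
  by exists m; split=> //; exists i.
have [S nS indS] := schanuel_independent n0 hz.
have SD := independent_disjoint_algebraic indS algD.
have [k hk] : exists k, forall i, i \notin S -> i != k -> i \in D.
  have : (#|~: D :\: S| <= 1)%N.
    rewrite cardsD (finset.setIidPr SD) leq_subLR addn1.
    exact: leq_trans cardD _.
  (* If S is the whole complement of D, any index serves as k. *)
  have [E _|[k kDS] /card_le1_eqP c1] := set_0Vmem (~: D :\: S).
    exists (lshift n (Ordinal n0)) => i iS _; apply: contraT => iD.
    by have : i \in ~: D :\: S; [rewrite !inE iS iD|rewrite E inE].
  exists k => i iS ik; apply: contraT => iD; move: ik.
  by rewrite (c1 i k) ?eqxx // !inE iS iD.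
case/eqP: (rw k).
apply: (algebraic_relation_specialize_lift indS) => // i iS ik.
  exact: algD (hk i iS ik).
exact: wz (hk i iS ik).
Qed.

End Schanuel.

(** * The identity theorem for exponential polynomials *)

Section ExponentialPolynomials.
Variable R : realType.

Definition expoly_eval (s : seq ({poly R} * R)) (t : R) : R :=
  \sum_(u <- s) u.1.[t] * expR (u.2 * t).

Definition expoly (f : R -> R) : Prop :=
  exists s, forall t, f t = expoly_eval s t.

Lemma expoly_eval_cons u s t :
  expoly_eval (u :: s) t = u.1.[t] * expR (u.2 * t) + expoly_eval s t.
Proof. by rewrite /expoly_eval big_cons. Qed.

Lemma is_derive_expoly s (t : R) : is_derive t (1 : R) (expoly_eval s)
  (expoly_eval [seq (u.1^`() + u.2 *: u.1, u.2) | u <- s] t).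
Proof.
elim: s => [|u s IHs].
  have -> : expoly_eval [::] = cst (0 : R).
    by apply/funext => z; rewrite /expoly_eval big_nil.
  exact: is_derive_cst.
have -> : expoly_eval (u :: s) =
    horner u.1 * (expR \o (fun z => u.2 * z)) + expoly_eval s.
  by apply/funext => z; rewrite expoly_eval_cons.
rewrite /= expoly_eval_cons; apply: is_deriveD.
have dlin : is_derive t (1 : R) (fun z : R => u.2 * z) u.2.
  have -> : (fun z : R => u.2 * z) = horner (u.2 *: 'X).
    by apply/funext => z; rewrite hornerZ hornerX.
  by apply: is_derive_eq; rewrite derivZ derivX hornerZ hornerC mulr1.
apply: is_derive_eq.
by rewrite /GRing.scale /= hornerD hornerZ; ring.
Qed.

Lemma expoly_eval_scale l s t :
  expoly_eval [seq (u.1, u.2 - l) | u <- s] t = expoly_eval s t * expR (- l * t).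
Proof.
rewrite /expoly_eval big_map mulr_suml; apply: eq_bigr => u _ /=.
by rewrite mulrDl expRD mulrA.
Qed.

(* Multiplying by an exponential makes the first term a polynomial; one
   differentiation then lowers the total degree, and the derivative vanishes
   on the same interval. *)
Lemma expoly_identity f e : 0 < e -> expoly f ->
  (forall t, `|t| < e -> f t = 0) -> forall t, f t = 0.
Proof.
move=> e0 [s fs] f0 t; rewrite fs.
have {f fs} f0 z : `|z| < e -> expoly_eval s z = 0 by move=> /f0; rewrite fs.
(* The successor makes the removal of a term with zero coefficient decrease the measure too. *)
have [n] := ubnP (\sum_(u <- s) (size u.1).+1).
elim: n => // n IHn in s f0 t *; case: s f0 => [|[p l] s] f0.
  by move=> _; rewrite /expoly_eval big_nil.
rewrite big_cons /= addSn ltnS => sn.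
have [p0|p0] := eqVneq p 0.
  rewrite expoly_eval_cons p0 horner0 mul0r add0r.
  apply: IHn; last by apply: leq_ltn_trans sn; apply: leq_addl.
  by move=> z /f0; rewrite expoly_eval_cons p0 horner0 mul0r add0r.
pose g := expoly_eval [seq (u.1, u.2 - l) | u <- (p, l) :: s].
pose s' := [seq (u.1^`() + u.2 *: u.1, u.2) |
             u <- [seq (u.1, u.2 - l) | u <- (p, l) :: s]].
have dg z : is_derive z (1 : R) g (expoly_eval s' z) by apply: is_derive_expoly.
have g0 z : `|z| < e -> g z = 0.
  by move=> /f0; rewrite /g expoly_eval_scale => ->; rewrite mul0r.
have dg0 z : `|z| < e -> expoly_eval s' z = 0.
  move=> ze; have [_ <-] := dg z.
  rewrite -[RHS](derive_cst (0 : R) z (1 : R)); apply: near_eq_derive.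
  have : open [set x : R | `|x| < e].
    have -> : [set x : R | `|x| < e] = ball 0 e.
      by apply/seteqP; split=> x /=; rewrite -ball_normE /= sub0r normrN.
    exact: ball_open.
  rewrite openE => /(_ z ze); rewrite /interior /=.
  by apply: filterS => x /g0.
have ds' z : expoly_eval s' z = 0.
  apply: IHn => //; apply: leq_ltn_trans sn.
  rewrite /s' big_cons /= subrr scale0r addr0 !big_map.
  apply: leq_add; first by rewrite lt_size_deriv.
  rewrite [leqRHS]big_seq_cond [leqLHS]big_seq_cond.
  apply: leq_sum => u _ /=; rewrite ltnS (leq_trans (size_polyD _ _)) // geq_max.
  rewrite size_scale_leq andbT.
  by have [->|/lt_size_deriv/ltnW] := eqVneq u.1 0; rewrite ?deriv0.
have gt : g t = g 0.
  by apply: is_derive_0_is_cst => z; rewrite -(ds' z).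
have /eqP : g t = 0 by rewrite gt g0 // normr0.
rewrite /g expoly_eval_scale mulf_eq0 => /orP[/eqP //|].
by rewrite gt_eqF ?expR_gt0.
Qed.

Lemma eq_expoly f g : f =1 g -> expoly f -> expoly g.
Proof. by move=> fg [s fs]; exists s => t; rewrite -fg. Qed.

Lemma expoly_affine a b : expoly (fun t => a + t * b).
Proof.
exists [:: (a%:P + b *: 'X, 0)] => t.
rewrite expoly_eval_cons /expoly_eval big_nil /= mul0r expR0.
by rewrite hornerD hornerZ hornerX hornerC; ring.
Qed.

Lemma expoly_cst a : expoly (fun=> a).
Proof. by apply: eq_expoly (expoly_affine a 0) => t; rewrite mulr0 addr0. Qed.

Lemma expoly_exp a b : expoly (fun t => expR (a + t * b)).
Proof.
exists [:: ((expR a)%:P, b)] => t.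
rewrite expoly_eval_cons /expoly_eval big_nil /= hornerC addr0.
by rewrite expRD [t * b]mulrC.
Qed.

Lemma expolyD f g : expoly f -> expoly g -> expoly (fun t => f t + g t).
Proof.
by case=> s fs [s' gs]; exists (s ++ s') => t; rewrite fs gs /expoly_eval big_cat.
Qed.

Lemma expolyM f g : expoly f -> expoly g -> expoly (fun t => f t * g t).
Proof.
case=> s fs [s' gs].
exists [seq (u.1 * v.1, u.2 + v.2) | u <- s, v <- s'] => t.
rewrite fs gs /expoly_eval big_allpairs_dep mulr_suml; apply: eq_bigr => u _.
rewrite mulr_sumr; apply: eq_bigr => v _ /=.
by rewrite hornerM mulrDl expRD; ring.
Qed.

(** Restriction to lines reduces the identity theorem in several variables to the case of one
    variable. *)
Definition line_expoly n (f : 'rV[R]_n -> R) : Prop :=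
  forall a b, expoly (fun t => f (a + t *: b)).

Lemma eq_line_expoly n (f g : 'rV[R]_n -> R) :
  f =1 g -> line_expoly f -> line_expoly g.
Proof. by move=> fg hf a b; apply: eq_expoly (hf a b) => t. Qed.

Lemma line_expoly_cst n c : line_expoly (fun _ : 'rV[R]_n => c).
Proof. by move=> a b; apply: expoly_cst. Qed.

Lemma line_expoly_linear n (q : 'I_n -> R) :
  line_expoly (fun x => \sum_i q i * x 0 i).
Proof.
move=> a b; apply: eq_expoly (expoly_affine (\sum_i q i * a 0 i)
  (\sum_i q i * b 0 i)) => t.
rewrite mulr_sumr -big_split; apply: eq_bigr => i _ /=.
by rewrite !mxE; ring.
Qed.

Lemma line_expoly_exp n (q : 'I_n -> R) :
  line_expoly (fun x => expR (\sum_i q i * x 0 i)).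
Proof.
move=> a b; apply: eq_expoly (expoly_exp (\sum_i q i * a 0 i)
  (\sum_i q i * b 0 i)) => t; congr expR.
rewrite mulr_sumr -big_split; apply: eq_bigr => i _ /=.
by rewrite !mxE; ring.
Qed.

Lemma line_expoly_coord n i : line_expoly (fun x : 'rV[R]_n => x 0 i).
Proof.
apply: eq_line_expoly (line_expoly_linear (fun j => (i == j)%:R)) => x.
rewrite (bigD1 i) //= eqxx mul1r big1 ?addr0 // => j.
by rewrite eq_sym => /negPf ->; rewrite mul0r.
Qed.

Lemma line_expoly_expcoord n i : line_expoly (fun x : 'rV[R]_n => expR (x 0 i)).
Proof.
apply: eq_line_expoly (line_expoly_exp (fun j => (i == j)%:R)) => x; congr expR.
rewrite (bigD1 i) //= eqxx mul1r big1 ?addr0 // => j.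
by rewrite eq_sym => /negPf ->; rewrite mul0r.
Qed.

Lemma line_expoly_mmap n N (A : comNzRingType) (f : A -> R)
    (h : 'I_N -> 'rV[R]_n -> R) (P : mpoly N A) :
  (forall i, line_expoly (h i)) -> line_expoly (fun x => mmap f (h^~ x) P).
Proof.
move=> hh a b; rewrite /mmap; elim: (msupp P) => [|m s IHs].
  by apply: eq_expoly (expoly_cst 0) => t; rewrite big_nil.
apply: eq_expoly (fun t => esym (big_cons _ _ _ _ _ _)) _.
apply: expolyD => //; apply: expolyM; first exact: expoly_cst.
rewrite /mmap1; elim: (index_enum _) => [|i r IHr].
  by apply: eq_expoly (expoly_cst 1) => t; rewrite big_nil.
apply: eq_expoly (fun t => esym (big_cons _ _ _ _ _ _)) _.
apply: expolyM => //; elim: (m i) => [|d IHd].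
  by apply: eq_expoly (expoly_cst 1) => t; rewrite expr0.
apply: eq_expoly (fun t => esym (exprS _ _)) _.
by apply: expolyM => //; apply: hh.
Qed.

Lemma line_expoly_identity n (f : 'rV[R]_n -> R) (O : set 'rV[R]_n) :
  line_expoly f -> open O -> O !=set0 -> (forall x, O x -> f x = 0) ->
  forall x, f x = 0.
Proof.
move=> hf oO [x0 Ox0] fO x.
have : \forall t \near (0 : R), O (x0 + t *: (x - x0)).
  have : (fun t : R => x0 + t *: (x - x0)) @ (0 : R) --> x0.
    have E : x0 = x0 + 0 *: (x - x0) by rewrite scale0r addr0.
    rewrite [X in _ --> X]E.
    by apply: cvgD; [exact: cvg_cst|apply: cvgZr_tmp; exact: cvg_id].
  by apply; apply: open_nbhs_nbhs.
move=> /nbhs_ballP[e /= e0 he].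
have -> : x = x0 + 1 *: (x - x0) by rewrite scale1r addrC subrK.
apply: (expoly_identity e0 (hf x0 (x - x0))) => t te; apply: fO; apply: he.
by rewrite -ball_normE /= sub0r normrN.
Qed.

(** * Continuity of polynomial expressions *)

Section Continuity.
Variable T : topologicalType.

Lemma continuous_bigsum I (s : seq I) (F : I -> T -> R) :
  (forall i, continuous (F i)) -> continuous (fun x => \sum_(i <- s) F i x).
Proof.
move=> cF; elim: s => [|i s IHs].
  by under eq_fun do rewrite big_nil; apply: cst_continuous.
under eq_fun do rewrite big_cons.
by move=> x; apply: cvgD; [exact: cF|exact: IHs].
Qed.

Lemma continuous_monomial n (h : 'I_n -> T -> R) (m : 'I_n -> nat) a :
  (forall i, continuous (h i)) ->
  continuous (fun x => a * \prod_(i < n) h i x ^+ m i).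
Proof.
move=> ch.
have cX i d : continuous (fun x => h i x ^+ d).
  elim: d => [|d IHd]; first by under eq_fun do rewrite expr0; apply: cst_continuous.
  under eq_fun do rewrite exprS.
  by move=> z; apply: cvgM; [exact: ch|exact: IHd].
have cM s : continuous (fun x => \prod_(i <- s) h i x ^+ m i).
  elim: s => [|i s IHs].
    by under eq_fun do rewrite big_nil; apply: cst_continuous.
  under eq_fun do rewrite big_cons.
  by move=> x; apply: cvgM; [exact: cX|exact: IHs].
by move=> x; apply: cvgM; [exact: cvg_cst|exact: cM].
Qed.

Lemma continuous_mmap N (A : comNzRingType) (f : A -> R)
    (h : 'I_N -> T -> R) (P : mpoly N A) :
  (forall i, continuous (h i)) -> continuous (fun x => mmap f (h^~ x) P).
Proof.
by move=> ch; apply: continuous_bigsum => m; apply: continuous_monomial.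
Qed.

Lemma continuous_subc (f : T -> R) c : continuous f -> continuous (fun x => f x - c).
Proof. by move=> cf x; apply: cvgB; [exact: cf|exact: cvg_cst]. Qed.

Lemma continuous_scale (f : T -> R) c : continuous f -> continuous (fun x => c * f x).
Proof. by move=> cf x; apply: cvgM; [exact: cvg_cst|exact: cf]. Qed.

End Continuity.

End ExponentialPolynomials.

(** * Rationally independent algebraic numbers and logarithms *)

Section RationallyFreeFamilies.
Variable R : realType.
Local Notation algebraic := (algebraicOver (ratr : rat -> R)).

Definition rat_free n (x : 'I_n -> R) : Prop :=
  forall q : 'I_n -> rat, \sum_i ratr (q i) * x i = 0 -> forall i, q i = 0.

Lemma algebraic_root_nat (x : R) d : (0 < d)%N -> algebraic (x ^+ d) -> algebraic x.
Proof.
move=> d0 /integral_algebraic xd; apply/integral_algebraic.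
apply: (@mxpoly.integral_root _ _ _ ('X^d - (x ^+ d)%:P)).
- by rewrite -size_poly_eq0 size_XnsubC.
- by rewrite /root !hornerE subrr.
move=> z /(nthP 0)[i _ <-]; rewrite coefB coefXn coefC.
apply: mxpoly.integral_sub.
  by case: eqP => _; [exact: mxpoly.integral1|exact: mxpoly.integral0].
by case: i => // i; exact: mxpoly.integral0.
Qed.

(** For n > 0 the numbers are the powers of 2^(1/n) with exponents below n. A rational relation is a
    polynomial of degree less than n with root 2^(1/n), impossible since X^n - 2 is irreducible by
    Eisenstein's criterion. *)
Lemma exists_algebraic_rat_free n : exists x : 'I_n -> R,
  (forall i, algebraic (x i)) /\ rat_free x.
Proof.
case: n => [|n]; first by exists (fun=> 0); split=> [[]|q _ []].
pose th : R := expR (ln 2 / n.+1%:R).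
have thn : th ^+ n.+1 = 2.
  by rewrite -expRM_natl mulrC divfK ?pnatr_eq0 // lnK // posrE.
exists (fun i => th ^+ i); split=> [i|q].
  apply: (@algebraic_root_nat _ n.+1) => //.
  rewrite exprAC thn -natrX -(ratr_nat R (2 ^ i)).
  exact: algebraic_id.
move=> qth i.
pose E : {poly int} := 'X^(n.+1) - 2%:P.
have lcE : lead_coef E = 1 by apply/monicP/monicXnsubC.
have irrE : irreducible_poly (map_poly (intr : int -> rat) E).
  apply/irreducible_rat_int; apply: (@eisenstein_crit 2) => //.
  - by rewrite size_XnsubC.
  - by rewrite lcE.
  - by rewrite coefB coefXn coefC.
  - rewrite size_XnsubC //= => j jn; rewrite coefB coefXn coefC ltn_eqF // sub0r.
    by case: j {jn}.
pose p : {poly rat} := \poly_(j < n.+1) q (inord j).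
have pth : root (map_poly ratr p) th.
  rewrite /root (@horner_coef_wide _ n.+1) ?size_map_poly ?size_poly //.
  rewrite -[X in _ == X]qth; apply/eqP; apply: eq_bigr => j _.
  by rewrite coef_map coef_poly ltn_ord /= inord_val.
have Eth : root (map_poly ratr (map_poly (intr : int -> rat) E)) th.
  have -> : map_poly ratr (map_poly (intr : int -> rat) E) = 'X^(n.+1) - 2%:P :> {poly R}.
    by rewrite /E !raddfB /= !map_polyXn !map_polyC /= ratr_int.
  by rewrite /root hornerD hornerN hornerXn hornerC thn subrr.
have p0 : p = 0.
  apply: contrapT => /eqP p0.
  have cop : coprimep (map_poly (intr : int -> rat) E) p.
    apply: contrapT => /negP ncop.
    have := irrE.2 (gcdp (map_poly intr E) p) ncop (dvdp_gcdl _ _).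
    move=> /eqp_size sE; have := dvdp_leq p0 (dvdp_gcdr (map_poly intr E) p).
    rewrite sE size_map_poly_id0 ?lcE // size_XnsubC // leqNgt.
    by rewrite ltnS size_poly.
  have := coprimep_root (x := th) (p := map_poly ratr (map_poly intr E))
    (q := map_poly ratr p).
  rewrite coprimep_map => /(_ cop Eth).
  by rewrite (rootP pth) eqxx.
have := congr1 (fun r : {poly rat} => r`_i) p0.
by rewrite coef_poly ltn_ord coef0 inord_val.
Qed.

Lemma prime_sequence : exists f : nat -> nat, (forall i, prime (f i)) /\ injective f.
Proof.
pose f := fix f i := if i is j.+1 then s2val (prime_above (f j)) else 2%N.
exists f; split.
  by case=> [|i] //=; case: (prime_above (f i)).
have ltf : {homo f : i j / (i < j)%N}.
  apply: homo_ltn => [j i k|i]; first exact: ltn_trans.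
  by rewrite /=; case: (prime_above (f i)).
move=> i j ij; case: (ltngtP i j) => // /ltf; by rewrite ij ltnn.
Qed.

Lemma logn_prod_distinct n (f : 'I_n -> nat) (a : 'I_n -> nat) j :
  (forall i, prime (f i)) -> injective f ->
  logn (f j) (\prod_i f i ^ a i) = a j.
Proof.
move=> prf injf; have f_gt0 i : (0 < f i ^ a i)%N by rewrite expn_gt0 prime_gt0.
rewrite (bigD1 j) //= lognM ?prodn_gt0 //.
rewrite lognX logn_prime // eqxx muln1 logn_coprime ?addn0 //.
apply: (big_ind (coprime (f j))) => [|m m' hm hm'|i ij]; first exact: coprimen1.
  by rewrite coprimeMr hm.
apply: coprimeXr; rewrite prime_coprime // dvdn_prime2 //.
by apply: contraNneq ij => /injf ->.
Qed.

(** Exponentiating an integer relation, with positive and negative coefficients on separate sides,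
    gives two equal products of prime powers. A rational relation is first multiplied by all its
    denominators. *)
Lemma ln_primes_rat_free n (f : 'I_n -> nat) :
  (forall i, prime (f i)) -> injective f -> rat_free (fun i => ln (f i)%:R : R).
Proof.
move=> prf injf.
have int_case (m : 'I_n -> int) : \sum_i (m i)%:~R * ln (f i)%:R = 0 :> R ->
    forall i, m i = 0.
  move=> mf i.
  pose a i := if 0 <= m i then `|m i|%N else 0%N.
  pose b i := if 0 <= m i then 0%N else `|m i|%N.
  have mE i' : m i' = (a i')%:Z - (b i')%:Z.
    by rewrite /a /b; case: (m i') => k /=; rewrite ?subr0 // NegzE sub0r.
  have expE (c : 'I_n -> nat) : expR (\sum_i (c i)%:R * ln (f i)%:R) =
      (\prod_i f i ^ c i)%:R :> R.
    rewrite expR_sum natr_prod; apply: eq_bigr => k _.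
    by rewrite expRM_natl lnK ?posrE ?ltr0n ?prime_gt0 // natrX.
  have ab : (\prod_i f i ^ a i = \prod_i f i ^ b i)%N.
    apply/eqP; rewrite -(eqr_nat R) -!expE; apply/eqP; congr expR.
    apply/eqP; rewrite -subr_eq0 -sumrB -[X in _ == X]mf; apply/eqP.
    by apply: eq_bigr => k _; rewrite [in RHS]mE rmorphB /= mulrBl.
  by rewrite mE -(logn_prod_distinct a i prf injf) ab logn_prod_distinct // subrr.
move=> q qf i.
pose D i := \prod_(k | k != i) denq (q k).
have DE k : (numq (q k) * D k)%:~R = (\prod_k denq (q k))%:~R * q k.
  rewrite (bigD1 k) //= -/(D k) !rmorphM /= -{3}(divq_num_den (q k)).
  by field; rewrite intr_eq0 denq_neq0.
have := int_case (fun k => numq (q k) * D k) _ i.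
have -> : \sum_k (numq (q k) * D k)%:~R * ln (f k)%:R =
    ratr (\prod_k denq (q k))%:~R * \sum_k ratr (q k) * ln (f k)%:R :> R.
  rewrite mulr_sumr; apply: eq_bigr => k _.
  by rewrite -ratr_int DE rmorphM mulrA.
rewrite qf mulr0.
move=> /(_ erefl)/eqP; rewrite mulf_eq0 numq_eq0 => /orP[/eqP //|].
by move=> /prodf_eq0[k _]; rewrite (negPf (denq_neq0 _)).
Qed.

(** The power of exponent [denq r] of this number is an integral power of p. *)
Lemma algebraic_exp_ratM (p : nat) (r : rat) : (0 < p)%N ->
  algebraic (expR (ratr r * ln p%:R)).
Proof.
move=> p0; apply: (@algebraic_root_nat _ `|denq r|).
  by rewrite absz_gt0 denq_neq0.
have E : (`|denq r|%N)%:R = (denq r)%:~R :> R.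
  by rewrite -[in RHS](gez0_abs (ltW (denq_gt0 r))).
rewrite -expRM_natl mulrA E -ratr_int -rmorphM /= [_ * r]mulrC -numqE ratr_int.
have algp (m : nat) : algebraic (expR (m%:R * ln p%:R)).
  rewrite expRM_natl lnK ?posrE ?ltr0n // -natrX -(ratr_nat R (p ^ m)).
  exact: algebraic_id.
case: (numq r) => m; first exact: algp.
by rewrite NegzE rmorphN mulNr expRN; apply: algebraic_inv; apply: algp.
Qed.

Lemma exists_log_rat_free n : exists x : 'I_n -> R,
  (forall i r, algebraic (expR (ratr r * x i))) /\ rat_free x.
Proof.
have [f [prf injf]] := prime_sequence.
exists (fun i => ln (f i)%:R); split=> [i r|].
  exact/algebraic_exp_ratM/prime_gt0.
by apply: ln_primes_rat_free => // i j /injf/val_inj.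
Qed.

Lemma rat_free_neq0 n (x : 'I_n -> R) i : rat_free x -> x i != 0.
Proof.
move=> hx; apply/eqP => xi.
suff : (i == i)%:R = 0 :> rat by rewrite eqxx => /eqP; rewrite oner_eq0.
apply: (hx (fun j => (j == i)%:R)); rewrite (bigD1 i) //= xi mulr0 add0r.
by rewrite big1 // => j /negPf ->; rewrite rmorph0 mul0r.
Qed.

Lemma rat_free_scale n (x : 'I_n -> R) (r : 'I_n -> rat) :
  rat_free x -> (forall i, r i != 0) -> rat_free (fun i => ratr (r i) * x i).
Proof.
move=> hx r0 q qx i; apply/eqP.
have /(_ _ i)/eqP := hx (fun i => q i * r i).
have -> : \sum_i ratr (q i * r i) * x i = 0.
  by rewrite -[RHS]qx; apply: eq_bigr => k _; rewrite rmorphM mulrA.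
by rewrite mulf_eq0 (negPf (r0 i)) orbF; apply.
Qed.

Lemma rat_multiple_near (a x e : R) : x != 0 -> 0 < e ->
  exists2 r : rat, r != 0 & `|a - ratr r * x| < e.
Proof.
move=> x0 e0; set d := e / `|x|.
have d0 : 0 < d by rewrite divr_gt0 // normr_gt0.
have [r r0 rd] : exists2 r : rat, r != 0 & `|a / x - ratr r| < d.
  have [ax|ax] := leP 0 (a / x).
    have /rat_in_itvoo[r] : a / x < a / x + d by rewrite ltrDl.
    rewrite in_itv /= => /andP[r1 r2]; exists r.
      by apply: contraTneq r1 => ->; rewrite rmorph0 -leNgt.
    by rewrite ltr_distl; apply/andP; split; lra.
  have /rat_in_itvoo[r] : a / x - d < a / x by rewrite gtrBl.
  rewrite in_itv /= => /andP[r1 r2]; exists r.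
    by apply: contraTneq r2 => ->; rewrite rmorph0 -leNgt ltW.
  by rewrite ltr_distl; apply/andP; split; lra.
exists r => //; have -> : a - ratr r * x = (a / x - ratr r) * x by field.
by rewrite normrM -ltr_pdivlMr ?normr_gt0.
Qed.

(** Density of the special points at which Schanuel's conjecture is applied: the coordinates of x
    are scaled by nonzero rationals, which preserves independence. *)
Lemma rat_multiple_in_open n (O : set 'rV[R]_n) (x : 'I_n -> R) :
  open O -> O !=set0 -> rat_free x -> exists z (r : 'I_n -> rat),
    [/\ O z, forall i, z 0 i = ratr (r i) * x i & rat_free (z 0)].
Proof.
move=> oO [a Oa] hx.
have /nbhs_ballP[e /= e0 he] : nbhs a O by apply: open_nbhs_nbhs.
have near i : exists r : rat, r != 0 /\ `|a 0 i - ratr r * x i| < e.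
  have [r r0 hr] := rat_multiple_near (a 0 i) (rat_free_neq0 i hx) e0.
  by exists r.
pose r i := projT1 (cid (near i)).
have [r0 hr] : (forall i, r i != 0) /\
    (forall i, `|a 0 i - ratr (r i) * x i| < e).
  by split=> i; rewrite /r; case: (cid (near i)) => ? [].
exists (\row_i (ratr (r i) * x i)), r; split=> [|i|].
- by apply: he; split=> // j i; rewrite ord1 mxE -ball_normE /=; apply: hr.
- by rewrite mxE.
- have -> : (\row_i (ratr (r i) * x i)) 0 = fun i => ratr (r i) * x i.
    by apply/funext => i; rewrite mxE.
  exact: rat_free_scale.
Qed.

End RationallyFreeFamilies.

(** * Zero sets of analytic functions in codimension one *)

Section Graphs.
Variable R : realType.

Lemma row_ballP n (x y : 'rV[R]_n) e : 0 < e ->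
  ball x e y <-> forall i, `|x 0 i - y 0 i| < e.
Proof.
move=> e0; split=> [[_ h] i|h]; first by have := h 0 i; rewrite -ball_normE.
by rewrite /ball /=; split=> // i j; rewrite ord1 -ball_normE; apply: h.
Qed.

Lemma sum_ffun_widen n N M (a : ('I_n -> nat) -> R) : (M < N)%N ->
  \sum_(m : {ffun 'I_n -> 'I_N} | [forall i, (m i < M.+1)%N]) a (fun i => m i) =
  \sum_(m : {ffun 'I_n -> 'I_M.+1}) a (fun i => m i).
Proof.
move=> MN.
pose wide (m : {ffun 'I_n -> 'I_M.+1}) : {ffun 'I_n -> 'I_N} :=
  [ffun i => widen_ord MN (m i)].
pose narrow (m : {ffun 'I_n -> 'I_N}) : {ffun 'I_n -> 'I_M.+1} :=
  [ffun i => inord (m i)].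
rewrite (reindex_onto wide narrow) /=; last first.
  by move=> m /forallP mM; apply/ffunP => i; apply: val_inj; rewrite !ffunE /= inordK.
apply: eq_big => [m|m _]; last first.
  by congr a; apply/funext => i; rewrite ffunE.
apply/andP; split; first by apply/forallP => i; rewrite ffunE /=.
by apply/eqP/ffunP => i; apply: val_inj; rewrite !ffunE /= inord_val.
Qed.

(** Both differences run over the multi-indices with some entry above M; the bound is the triangle
    inequality. *)
Lemma sum_ffun_dist n N M (a : ('I_n -> nat) -> R) : (M < N)%N ->
  `|\sum_(m : {ffun 'I_n -> 'I_N}) a (fun i => m i) -
    \sum_(m : {ffun 'I_n -> 'I_M.+1}) a (fun i => m i)| <=
  \sum_(m : {ffun 'I_n -> 'I_N}) `|a (fun i => m i)| -
    \sum_(m : {ffun 'I_n -> 'I_M.+1}) `|a (fun i => m i)|.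
Proof.
move=> MN; rewrite -!(sum_ffun_widen (N := N)) //.
rewrite -(sum_ffun_widen (fun m => `|a m|) MN).
rewrite [X in `|X - _|](bigID (fun m : {ffun 'I_n -> 'I_N} =>
  [forall i, (m i < M.+1)%N])) /=.
rewrite [X in _ <= X - _](bigID (fun m : {ffun 'I_n -> 'I_N} =>
  [forall i, (m i < M.+1)%N])) /=.
by rewrite ![_ + _ - _]addrAC !subrr !add0r ler_norm_sum.
Qed.

(** Weierstrass test: on a ball of half the radius, every term is dominated by its absolute value at
    the corner [y0], so the continuous partial sums converge uniformly. *)
Lemma analytic_at_continuous n (f : 'rV[R]_n -> R) x : analytic_at f x ->
  exists2 e, 0 < e & forall y, ball x e y -> f @ y --> f y.
Proof.
case=> c /= /nbhs_ballP[d /= d0 hd].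
pose term (y : 'rV[R]_n) (m : 'I_n -> nat) :=
  c m * \prod_(i < n) (y 0 i - x 0 i) ^+ m i.
pose S N y := \sum_(m : {ffun 'I_n -> 'I_N}) term y (fun i => m i).
pose T N y := \sum_(m : {ffun 'I_n -> 'I_N}) `|term y (fun i => m i)|.
have hT y : ball x d y -> cvgn (T^~ y) by move=> /hd[].
have hS y : ball x d y -> (S^~ y) @ \oo --> f y by move=> /hd[].
pose r := d / 2; have r0 : 0 < r by rewrite divr_gt0.
pose y0 := \row_i (x 0 i + r) : 'rV[R]_n.
have y0d : ball x d y0.
  apply/row_ballP => // i; rewrite mxE opprD addNKr normrN gtr0_norm // /r; lra.
have bd y : ball x r y -> ball x d y by apply: le_ball; rewrite /r; lra.
have term_le y m : ball x r y -> `|term y m| <= `|term y0 m|.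
  move=> /(row_ballP _ _ r0) hy; rewrite /term !normrM ler_wpM2l // !normr_prod.
  apply: ler_prod => i _; rewrite normr_ge0 /= !normrX lerXn2r ?nnegrE //.
  have -> : y0 0 i - x 0 i = r by rewrite mxE addrC addKr.
  by rewrite [leRHS]gtr0_norm // distrC; apply/ltW/hy.
exists r => // y hy; apply/(cvgrPdist_lt (F := nbhs y)) => e e0.
have [M hM] : exists M, forall z, ball x r z -> `|f z - S M.+1 z| <= e / 4.
  have e8 : 0 < e / 8 by rewrite divr_gt0.
  have /cvgrPdist_lt/(_ _ e8)[N0 _ hN0] := hT _ y0d.
  have TN0 N : (N0 < N)%N -> T N y0 - T N0.+1 y0 <= e / 4.
    move=> N0N; have := hN0 N (ltnW N0N); have := hN0 N0.+1 (leqnSn N0).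
    rewrite /= !ltr_norml => /andP[? ?] /andP[? ?]; lra.
  exists N0 => z hz.
  have fz := hS _ (bd _ hz).
  have : (fun N => `|S N z - S N0.+1 z|) @ \oo --> `|f z - S N0.+1 z|.
    by apply: cvg_norm; apply: cvgB => //; apply: cvg_cst.
  move=> lim_le; apply: (cvgr_to_le lim_le); exists N0.+1 => // N /= N0N.
  apply: le_trans (TN0 N N0N); apply: (le_trans (sum_ffun_dist _ N0N)).
  rewrite /T -(sum_ffun_widen (fun m => `|term z m|) N0N).
  rewrite -(sum_ffun_widen (fun m => `|term y0 m|) N0N).
  rewrite [X in X - _ <= _](bigID (fun m : {ffun 'I_n -> 'I_N} =>
    [forall i, (m i < N0.+1)%N])) /=.
  rewrite [X in _ <= X - _](bigID (fun m : {ffun 'I_n -> 'I_N} =>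
    [forall i, (m i < N0.+1)%N])) /=.
  rewrite ![_ + _ - _]addrAC !subrr !add0r; apply: ler_sum => m _.
  exact: term_le.
have cS : continuous (S M.+1).
  apply: continuous_bigsum => m; apply: continuous_monomial => i.
  exact/continuous_subc/coord_continuous.
have near_ball : \forall z \near y, ball x r z.
  by apply: open_nbhs_nbhs; split=> //; exact: ball_open.
have e2 : 0 < e / 2 by rewrite divr_gt0.
have /cvgrPdist_lt/(_ _ e2) hcS := cS y.
near=> z.
have h1 := hM y hy; have h2 : `|f z - S M.+1 z| <= e / 4 by apply: hM; near: z.
have h3 : `|S M.+1 y - S M.+1 z| < e / 2 by near: z.
move: h1 h2 h3; rewrite !ler_norml ltr_norml => /andP[? ?] /andP[? ?] /andP[? ?].
rewrite ltr_norml; apply/andP; split; lra.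
Unshelve. all: by end_near. Qed.
(** A point x' of the other coordinates is represented by any x in R^n extending it, the j-th entry
    being overwritten; this avoids a separate space of dimension n - 1. *)
Definition replace_coord n (j : 'I_n) (x : 'rV[R]_n) (t : R) : 'rV[R]_n :=
  \row_i if i == j then t else x 0 i.

Lemma replace_coordE n (j : 'I_n) x t : replace_coord j x t 0 j = t.
Proof. by rewrite mxE eqxx. Qed.

Lemma replace_coordN n (j : 'I_n) x t i : i != j -> replace_coord j x t 0 i = x 0 i.
Proof. by rewrite mxE => /negPf ->. Qed.

Lemma replace_coord_id n (j : 'I_n) x : replace_coord j x (x 0 j) = x.
Proof. by apply/rowP => i; rewrite mxE; case: eqVneq => [->|]. Qed.

Lemma ball_replace_coord n (j : 'I_n) (x y : 'rV[R]_n) s t e : 0 < e ->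
  ball x e y -> `|s - t| < e -> ball (replace_coord j x s) e (replace_coord j y t).
Proof.
move=> e0 /(row_ballP _ _ e0) hxy hst; apply/row_ballP => // i.
by rewrite !mxE; case: eqP.
Qed.

Lemma replace_coord_continuous n (j : 'I_n) :
  continuous (fun xt : 'rV[R]_n * R => replace_coord j xt.1 xt.2).
Proof.
move=> [x t] A /nbhs_ballP[e /= e0 hA]; apply/nbhs_ballP; exists e => //=.
move=> [y s] /= [hy]; rewrite -ball_normE /= => hs.
by apply: hA; apply: ball_replace_coord.
Qed.

Lemma replace_coord_continuousl n (j : 'I_n) t :
  continuous (fun x : 'rV[R]_n => replace_coord j x t).
Proof.
move=> x A /nbhs_ballP[e /= e0 hA]; apply/nbhs_ballP; exists e => //= y hy.
by apply: hA; apply: ball_replace_coord; rewrite // subrr normr0.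
Qed.

Lemma replace_coord_continuousr n (j : 'I_n) (x : 'rV[R]_n) :
  continuous (replace_coord j x).
Proof.
move=> t A /nbhs_ballP[e /= e0 hA]; apply/nbhs_ballP; exists e => //= s.
rewrite -ball_normE /= => hs.
by apply: hA; apply: ball_replace_coord => //; apply: ballxx.
Qed.

Lemma mul_cvg_at (T : topologicalType) (f g : T -> R) x :
  f @ x --> f x -> g @ x --> g x -> f y * g y @[y --> x] --> f x * g x.
Proof. exact: cvgM. Qed.

(** Near 0 the difference quotient has the sign of its nonzero limit, so g takes opposite signs at h
    and -h. *)
Lemma derive_neq0_sign (g : R -> R) l : 
  (fun h => h^-1 * (g h - g 0)) @ 0^' --> l -> l != 0 -> g 0 = 0 ->
  forall e, 0 < e -> exists2 h, 0 < h < e & g h * g (- h) < 0.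
Proof.
move=> hl l0 g0 e e0.
have l2 : 0 < `|l| by rewrite normr_gt0.
have /cvgrPdist_lt/(_ _ l2) := hl.
rewrite /dnbhs /within /= => /nbhs_ballP[d /= d0 hd].
pose h := Num.min (d / 2) (e / 2).
have h0 : 0 < h by rewrite lt_min !divr_gt0.
have hd2 : h < d.
  have : h <= d / 2 by rewrite ge_min lexx.
  by move=> ?; lra.
have he2 : h < e.
  have : h <= e / 2 by rewrite ge_min lexx orbT.
  by move=> ?; lra.
have key z : z != 0 -> `|z| < d -> 0 < l * (z^-1 * g z).
  move=> z0 zd; have := hd z; rewrite -ball_normE /= sub0r normrN g0 subr0.
  move=> /(_ zd z0); set w := z^-1 * g z => lw.
  have [lp|ln|l00] := ltgtP l 0; last by rewrite l00 eqxx in l0.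
    rewrite nmulr_rgt0 //; move: lw; rewrite (ltr0_norm lp) ltr_norml => /andP[? ?]; lra.
  rewrite pmulr_rgt0 //; move: lw; rewrite (gtr0_norm ln) ltr_norml => /andP[? ?]; lra.
exists h; first by rewrite h0.
have k1 : 0 < l * (h^-1 * g h) by apply: key; rewrite ?gt_eqF // gtr0_norm.
have k2 : 0 < l * ((- h)^-1 * g (- h)).
  by apply: key; rewrite ?normrN ?gtr0_norm // oppr_eq0 gt_eqF.
have := mulr_gt0 k1 k2.
have -> : l * (h^-1 * g h) * (l * ((- h)^-1 * g (- h))) =
    - (l ^+ 2 * (h^-1) ^+ 2 * (g h * g (- h))) by rewrite invrN; ring.
rewrite oppr_gt0 pmulr_rlt0 //.
by rewrite mulr_gt0 // exprn_even_gt0 //= invr_eq0 gt_eqF.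
Qed.

(* Only a change of sign along the j-th axis is used, so that no implicit function
   theorem is needed; t need not depend continuously on x. *)
Lemma zero_section n (g : 'rV[R]_n -> R) (U : set 'rV[R]_n) c j :
  (\forall y \near c, g @ y --> g y) -> nbhs c U -> g c = 0 ->
  'D_(delta_mx 0 j) g c != 0 ->
  exists a b (O : set 'rV[R]_n), [/\ open O, O c &
    forall x, O x -> exists2 t, a <= t <= b &
      U (replace_coord j x t) /\ g (replace_coord j x t) = 0].
Proof.
move=> cg Uc gc dg.
have /nbhs_ballP[e /= e0 he] : nbhs c [set y | (g @ y --> g y) /\ U y].
  by apply: filterI.
pose phi h := g (replace_coord j c (c 0 j + h)).
have phiE h : phi h = g (h *: delta_mx 0 j + c).
  congr g; apply/rowP => i; rewrite !mxE eqxx /=.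
  by have [->|_] := eqVneq i j; rewrite ?mulr1 ?mulr0 ?add0r // addrC.
have dphi : (fun h => h^-1 * (phi h - phi 0)) @ 0^' --> 'D_(delta_mx 0 j) g c.
  have := cvg_inNpoint dg.
  rewrite /derive; under eq_fun do rewrite /= -phiE.
  by rewrite [g c](_ : _ = phi 0) // phiE scale0r add0r.
have phi0 : phi 0 = 0 by rewrite phiE scale0r add0r.
have [h /andP[h0 hlt] hneg] := derive_neq0_sign dphi dg phi0 (divr_gt0 e0 (ltr0n _ 2)).
have hball x t : ball c (e / 2) x -> `|c 0 j - t| <= h ->
    ball c e (replace_coord j x t).
  move=> hx ht; rewrite -[c](replace_coord_id j).
  apply: ball_replace_coord => //.
    by apply: le_ball hx; rewrite ler_pdivrMr // ler_peMr ?ler1n // ltW.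
  by apply: (le_lt_trans ht); apply: (lt_trans hlt); lra.
(* A negative value of [psi] means that g changes sign between the two ends of the segment above x.
   This holds at c and persists nearby by continuity at c. *)
pose psi (x : 'rV[R]_n) := g (replace_coord j x (c 0 j + h)) *
                   g (replace_coord j x (c 0 j - h)).
have hh : `|c 0 j - (c 0 j + h)| <= h.
  by rewrite opprD addNKr normrN gtr0_norm.
have hNh : `|c 0 j - (c 0 j - h)| <= h by rewrite opprB addrC subrK gtr0_norm.
have e2 : 0 < e / 2 by rewrite divr_gt0.
have cpsi : psi @ c --> psi c.
  apply: (@mul_cvg_at _ (fun x => g (replace_coord j x (c 0 j + h)))
    (fun x => g (replace_coord j x (c 0 j - h)))).
  - apply: (@cvg_comp _ _ _ (fun x => replace_coord j x (c 0 j + h)) g _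
      (nbhs (replace_coord j c (c 0 j + h)))).
      exact: replace_coord_continuousl.
    by have [] := he _ (hball c _ (ballxx _ e2) hh).
  - apply: (@cvg_comp _ _ _ (fun x => replace_coord j x (c 0 j - h)) g _
      (nbhs (replace_coord j c (c 0 j - h)))).
      exact: replace_coord_continuousl.
    by have [] := he _ (hball c _ (ballxx _ e2) hNh).
have psic : psi c < 0 by [].
have nearO : nbhs c [set x | psi x < 0 /\ ball c (e / 2) x].
  apply: filterI; first exact: (cvgr_lt _ cpsi).
  exact: nbhsx_ballx.
exists (c 0 j - h), (c 0 j + h), (interior [set x | psi x < 0 /\ ball c (e / 2) x]).
split; [exact: open_interior|exact: nearO|].
move=> x /interior_subset[px bx].
have seg t : c 0 j - h <= t <= c 0 j + h -> `|c 0 j - t| <= h.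
  by move=> /andP[? ?]; rewrite ler_norml; apply/andP; split; lra.
have [|||t] := @IVT R (fun t => g (replace_coord j x t)) (c 0 j - h) (c 0 j + h) 0.
- by lra.
- apply: continuous_in_subspaceT => t; rewrite inE /= in_itv /= => ht.
  apply: (@cvg_comp _ _ _ (replace_coord j x) g _ (nbhs (replace_coord j x t))).
    exact: replace_coord_continuousr.
  by have [] := he _ (hball x _ bx (seg t ht)).
- move: px; rewrite /psi; set u := g _; set v := g _.
  rewrite ge_min le_max; case: (ltgtP u 0) => [u0|u0|->]; rewrite ?mul0r ?ltxx //.
    by rewrite nmulr_rlt0 // => /ltW ->; rewrite orbT.
  by rewrite pmulr_rlt0 // => /ltW ->; rewrite orbT.
rewrite in_itv /= => ht gt; exists t => //; split=> //.
by have [] := he _ (hball x _ bx (seg t ht)).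
Qed.

End Graphs.

(** * Closed sets and their prime ideals *)

Section ClosedSets.
Variables (R : realType) (K : {pred R}) (hK : GRing.divring_closed K).
Local Notation Kt := (subfield hK).
Local Notation ev := (mmap (\val : Kt -> R)).

Lemma poly_over_subfield m (P : mpoly m R) :
  poly_over K P <-> exists Q : mpoly m Kt, P = map_mpoly \val Q.
Proof.
split=> [|[Q ->]]; last first.
  apply/(@mpolyOverP _ _ (divring_pred hK)) => i.
  by rewrite mcoeff_map_mpoly; apply: subfield_valP.
move=> /(@mpolyOverP _ _ (divring_pred hK)) hP.
exists (\sum_(i <- msupp P) @Subfield _ _ hK _ (hP i) *: mpolyX _ i).
rewrite [LHS](mpolyE P) rmorph_sum; apply: eq_bigr => i _.
pose v : {rmorphism Kt -> R} := \val.
by apply/esym; rewrite -[LHS]/(map_mpoly v (_ *: _)) map_mpolyZ map_mpolyX.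
Qed.

Section Family.
Variables (T : Type) (N : nat) (iota : T -> 'I_N -> R).

(** Covers both topologies: [iota] gives the coordinates of a point for algebraic sets, and is
    [exp_graph] for exponential sets. *)
Definition closed_family : set (set T) :=
  [set V | exists k (Q : 'I_k -> mpoly N Kt),
    V = [set x | forall i, ev (iota x) (Q i) = 0]].

Definition vanishing (V : set T) (F : mpoly N Kt) : Prop :=
  forall x, V x -> ev (iota x) F = 0.

Lemma closed_vanishing V x : closed_family V ->
  (forall F, vanishing V F -> ev (iota x) F = 0) -> V x.
Proof. by case=> k [Q ->] h i; apply: h => y; apply. Qed.

Lemma closed_family_cut V F : closed_family V ->
  closed_family (V `&` [set x | ev (iota x) F = 0]).
Proof.
case=> k [Q ->].
exists k.+1, (fun i => if unlift ord_max i is Some i' then Q i' else F).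
apply/seteqP; split=> [x [hQ hF] i|x h].
  by case: unliftP => [i' _|_]; [exact: hQ|exact: hF].
split=> [i|]; last by have := h ord_max; rewrite unlift_none.
by have := h (lift ord_max i); rewrite liftK.
Qed.

Lemma vanishing_ideal V : ideal (vanishing V).
Proof.
split=> [x _|F G hF hG x Vx|F G hG x Vx].
- exact: rmorph0.
- by rewrite rmorphB /= hF // hG // subrr.
- by rewrite rmorphM /= hG // mulr0.
Qed.

(** If F G vanishes on V but neither factor does, the zeros of F and of G cut V into two proper
    closed subsets. *)
Lemma irreducible_vanishing V : irreducible_set closed_family V ->
  prime_ideal (vanishing V).
Proof.
case=> cV _ irrV; split=> [|F G hFG]; first exact: vanishing_ideal.
apply: contrapT => /not_orP[nF nG]; apply: irrV.
exists (V `&` [set x | ev (iota x) F = 0]), (V `&` [set x | ev (iota x) G = 0]).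
have cut H : ~ vanishing V H -> V `&` [set x | ev (iota x) H = 0] `<` V.
  by move=> nH; split=> [|sub]; [exact: subIsetl|apply: nH => x /sub[]].
split; [exact: closed_family_cut|exact: closed_family_cut|exact: cut|exact: cut|].
apply/seteqP; split=> [x Vx|x [[]|[]] //].
have /eqP := hFG x Vx; rewrite rmorphM mulf_eq0 => /orP[]/eqP; first by left.
by right.
Qed.

End Family.

Lemma exponential_setE n : exponential_set K (n := n) = closed_family (@exp_graph R n).
Proof.
apply/seteqP; split=> V [k [f]].
  move=> [hf ->].
  have hQ i : exists Q : mpoly (n + n) Kt, f i = E (map_mpoly \val Q).
    by case: (hf i) => P /poly_over_subfield[Q ->] ->; exists Q.
  have [Q fQ] := choice hQ; exists k, Q.
  by apply/seteqP; split=> x h i; have := h i; rewrite fQ /E /peval meval_map_mpoly.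
move=> ->; exists k, (fun i => E (map_mpoly \val (f i))); split=> [i|].
  by exists (map_mpoly \val (f i)) => //; apply/poly_over_subfield; exists (f i).
by apply/seteqP; split=> x h i; have := h i; rewrite /E /peval meval_map_mpoly.
Qed.

Lemma algebraic_setE m : algebraic_set K (m := m) =
  closed_family (fun x : 'rV[R]_m => x 0).
Proof.
apply/seteqP; split=> V [k [f]].
  move=> [/(_ _)/poly_over_subfield hf ->].
  have [Q fQ] := choice hf; exists k, Q.
  by apply/seteqP; split=> x h i; have := h i; rewrite fQ /peval meval_map_mpoly.
move=> ->; exists k, (fun i => map_mpoly \val (f i)); split=> [i|].
  by apply/poly_over_subfield; exists (f i).
by apply/seteqP; split=> x h i; have := h i; rewrite /peval meval_map_mpoly.
Qed.

Lemma ideal_preim (A B : comNzRingType) (f : {rmorphism A -> B}) I :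
  ideal I -> ideal (I \o f).
Proof.
case=> I0 IB IM; split=> [|a b|a b] /=; rewrite ?rmorph0 ?rmorphB ?rmorphM //.
- exact: IB.
- exact: IM.
Qed.

Lemma prime_ideal_preim (A B : comNzRingType) (f : {rmorphism A -> B}) I :
  prime_ideal I -> prime_ideal (I \o f).
Proof.
case=> iI IP; split=> [|a b]; first exact: ideal_preim.
by rewrite /= rmorphM; apply: IP.
Qed.

Lemma irreducible_dichotomy n (P : mpoly (n + n) Kt) (C : set 'rV[R]_n) :
  P != 0 ->
  irreducible_set (closed_family (fun x : 'rV[R]_(n + n) => x 0))
    [set x : 'rV[R]_(n + n) | ev (x 0) P = 0] ->
  irreducible_set (closed_family (@exp_graph R n)) C ->
  C `<=` [set x | ev (exp_graph x) P = 0] ->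
  C = [set x | ev (exp_graph x) P = 0] \/
  forall k, exists2 s : mpoly (n + n).-1 Kt, s != 0 &
    forall x, C x -> ev (exp_graph x \o lift k) s = 0.
Proof.
set W := [set x : 'rV[R]_(n + n) | ev (x 0) P = 0] => P0 irrW irrC CP.
case: (EM (forall k, exists2 s : mpoly (n + n).-1 Kt, s != 0 &
    forall x, C x -> ev (exp_graph x \o lift k) s = 0)); first by right.
move=> /existsNP[k nok]; left; apply/seteqP; split=> // x Px.
have [cC _ _] := irrC; apply: (closed_vanishing cC) => F hF.
pose y := row_mx x (map_mx expR x).
have WC z : C z -> W (row_mx z (map_mx expR z)) by move=> /CP.
(* A point (x, e^x) with x in the zero set of E(P) lies in W, so it suffices that F vanish on W. *)
suff vW : vanishing (fun x : 'rV[R]_(n + n) => x 0) W F by exact: (vW y Px).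
rewrite -(poly_of_mpolyK k F).
apply: (@prime_ideal_poly_eq _ (vanishing (@exp_graph R n) C \o mpoly_of_poly k)
   (vanishing (fun x : 'rV[R]_(n + n) => x 0) W \o mpoly_of_poly k)).
- exact/ideal_preim/vanishing_ideal.
- exact/prime_ideal_preim/irreducible_vanishing.
- by move=> p hp z /WC; apply: hp.
- move=> s hs; apply: contrapT => /eqP s0; apply: nok; exists s => // z /hs.
  by rewrite mpoly_of_polyC mmap_rename.
- exists (poly_of_mpoly k P); last by move=> z; rewrite /= poly_of_mpolyK.
  by apply: contraNneq P0 => P0; rewrite -(poly_of_mpolyK k P) P0 rmorph0.
- by rewrite /= poly_of_mpolyK.
Qed.

End ClosedSets.

(** * Components, strata and sections in codimension one *)

Section Strata.
Variables (R : realType) (K : {pred R}) (n : nat).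
Implicit Types V C : set 'rV[R]_n.

Lemma component_sub V C : irreducible_component K V C -> C `<=` V.
Proof. by case=> k [D [[_ -> _] [i ->]]] x Dx; exists i. Qed.

Lemma component_irreducible V C : irreducible_component K V C ->
  irreducible_set (exponential_set K (n := n)) C.
Proof. by case=> k [D [[irrD _ _] [i ->]]]. Qed.

Lemma stratum_sub V i : stratum K V i `<=` V.
Proof.
have RegS (W : set 'rV[R]_n) : Reg K W `<=` W.
  move=> x [[_ [Wx _]]|[_ [C [hC [Cx _] _]]]] //.
  exact: (component_sub hC) Cx.
apply: (subset_trans (RegS _)).
by elim: i => [|i IHi] //= x [/IHi].
Qed.

End Strata.

(** In R^(n+1), a stratum of dimension n is near some point the zero set of one analytic function
    with nonzero gradient; j is a direction in which its partial derivative is nonzero. *)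
Lemma has_dim_section (R : realType) (K : {pred R}) n (C : set 'rV[R]_n.+1) :
  has_dim K C n -> exists j a b (O : set 'rV[R]_n.+1), [/\ open O, O !=set0 &
    forall x, O x -> exists2 t, a <= t <= b & C (replace_coord j x t)].
Proof.
case=> -[i [c [_ [Mc [U [g [oU Uc ag MU rk]]]]]]] _.
have MC := @stratum_sub R K n.+1 C i.
set M := stratum K C i in Mc MU MC.
have n1 : (n.+1 - n = 1)%N by rewrite subSnn.
move: g ag MU rk; rewrite n1 => g ag MU rk.
have [j gj] : exists j, 'D_(delta_mx 0 j) (g 0) c != 0.
  apply: contrapT => /forallNP noj; move: rk.
  suff -> : jacobian_matrix g c = 0 by rewrite mxrank0.
  apply/matrixP => i' j; rewrite !mxE ord1.
  by apply: contrapT => /eqP; apply: noj.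
have gE y : U y -> M y <-> g 0 y = 0.
  move=> Uy; split=> [My|gy].
    have : (M `&` U) y by split.
    by rewrite MU => -[].
  have : (Zer g `&` U) y by split=> // i'; rewrite ord1.
  by rewrite -MU => -[].
have [] := @zero_section R n.+1 (g 0) U c j.
- have [e e0 he] := analytic_at_continuous (ag 0 c Uc).
  by apply/nbhs_ballP; exists e.
- by apply: open_nbhs_nbhs.
- exact/gE.
- exact: gj.
move=> a [b [W [oW Wc hW]]]; exists j, a, b, W; split=> //; first by exists c.
by move=> x /hW[t tab [Uz gz]]; exists t => //; apply/MC/gE.
Qed.

(** * Hyperplane components *)

(** A finite form of Baire's theorem: if the first closed set does not contain U, the argument
    continues in the nonempty open set where it is removed from U. *)
Lemma finite_closed_cover (T : topologicalType) (I : eqType) (s : seq I) (B : I -> set T)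
    (U : set T) : (forall i, closed (B i)) -> open U -> U !=set0 ->
  (forall W, open W -> W !=set0 -> W `<=` U ->
     exists2 x, W x & exists2 i, i \in s & B i x) ->
  exists i W, [/\ open W, W !=set0 & W `<=` B i].
Proof.
move=> cB; elim: s U => [|i s IHs] U oU U0 hU.
  by have [x _ [i []]] := hU U oU U0 (@subset_refl _ _).
have [UB|nUB] := EM (U `<=` B i); first by exists i, U.
apply: (IHs (U `&` ~` B i)).
- by apply: openI => //; exact: closed_openC.
- by apply: contrapT => h; apply: nUB => x Ux; apply: contrapT => nB; apply: h; exists x.
move=> W oW W0 WU.
have [x Wx [i']] := hU W oW W0 (subset_trans WU (@subIsetl _ _ _)).
rewrite inE => /orP[/eqP -> Bx|i's Bx]; first by have [_] := WU x Wx.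
by exists x => //; exists i'.
Qed.

Lemma poly_roots_seq (F : fieldType) (p : {poly F}) : p != 0 ->
  exists s : seq F, forall x, root p x -> x \in s.
Proof.
have [n] := ubnP (size p); elim: n p => // n IHn p sp p0.
have [[x px]|nox] := EM (exists x, root p x); last first.
  by exists [::] => x px; case: nox; exists x.
have /factor_theorem[q pE] := px.
have q0 : q != 0 by apply: contraNneq p0 => q0; rewrite pE q0 mul0r.
have [|s hs] := IHn q _ q0.
  by move: sp; rewrite pE size_Mmonic ?monicXsubC // size_XsubC addn2.
exists (x :: s) => y; rewrite pE rootM root_XsubC inE => /orP[/hs ->|->//].
by rewrite orbT.
Qed.

Section Relations.
Variables (R : realType) (n : nat).
Local Notation algebraic := (algebraicOver (ratr : rat -> R)).

Lemma algebraic_ratr q : algebraic (ratr q).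
Proof. exact: algebraic_id. Qed.

Lemma algebraic_nat m : algebraic m%:R.
Proof. by rewrite -(ratr_nat R m); apply: algebraic_ratr. Qed.

Lemma rat_free_int_free (x : 'rV[R]_n) : rat_free (x 0) -> int_free x.
Proof.
move=> hx m mx i; apply/eqP; rewrite -(intr_eq0 rat); apply/eqP.
apply: (hx (fun i => (m i)%:~R)); rewrite -[RHS]mx.
by apply: eq_bigr => k _; rewrite ratr_int.
Qed.

Definition lin (j : 'I_n) (q : 'I_n -> rat) (x : 'rV[R]_n) : R :=
  \sum_(i < n | i != j) ratr (q i) * x 0 i.

Lemma lin_replace_coord j q x t : lin j q (replace_coord j x t) = lin j q x.
Proof. by apply: eq_bigr => i ij; rewrite replace_coordN. Qed.

(** The coefficient of t cannot vanish, since the other coordinates are independent; the relation is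
    solved for t. *)
Lemma relation_lin j (x : 'rV[R]_n) t (m : 'I_n -> int) : rat_free (x 0) ->
  (exists i, m i != 0) ->
  \sum_(i < n) (m i)%:~R * replace_coord j x t 0 i = 0 ->
  exists q, t = lin j q x.
Proof.
move=> hx [k mk]; rewrite (bigD1 j) //= replace_coordE => mx.
have mx' : (m j)%:~R * t + \sum_(i < n | i != j) (m i)%:~R * x 0 i = 0.
  by rewrite -[RHS]mx; congr (_ + _); apply: eq_bigr => i ij; rewrite replace_coordN.
have mj : m j != 0.
  apply: contraNneq mk => mj; move: mx'; rewrite mj mul0r add0r => mx'.
  have [->|kj] := eqVneq k j; first exact/eqP.
  rewrite -(intr_eq0 rat); apply/eqP.
  have := hx (fun i => if i == j then 0 else (m i)%:~R) _ k.
  rewrite (negPf kj); apply; rewrite (bigD1 j) //= eqxx rmorph0 mul0r add0r -[RHS]mx'.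
  by apply: eq_bigr => i /negPf ->; rewrite ratr_int.
exists (fun i => - (m i)%:~R / (m j)%:~R).
have mjR : (m j)%:~R != 0 :> R by rewrite intr_eq0.
apply: (mulfI mjR).
rewrite -[LHS](addrK (\sum_(i < n | i != j) (m i)%:~R * x 0 i)) mx' sub0r.
rewrite -sumrN /lin mulr_sumr; apply: eq_bigr => i _.
by rewrite fmorph_div rmorphN /= !ratr_int; field.
Qed.

End Relations.

Section Hyperplane.
Variables (R : realType) (hS : Schanuel_conjecture R).
Variables (K : {pred R}) (hK : real_algebraic_extension K).
Local Notation Kt := (subfield hK.1).
Local Notation ev := (mmap (\val : Kt -> R)).
Local Notation evA := (mmap (\val : real_alg R -> R)).
Local Notation algebraic := (algebraicOver (ratr : rat -> R)).

Lemma subfield_real_algP (a : Kt) :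
  \val a \in [pred a : R | `[< algebraic a >]].
Proof. by apply/asboolP/hK.2; exact: subfield_valP. Qed.

Definition to_real_alg : {rmorphism Kt -> real_alg R} :=
  subfield_corestr (real_alg_closed R) subfield_real_algP.

Lemma ev_real_alg N (z : 'I_N -> R) (s : mpoly N Kt) :
  evA z (map_mpoly to_real_alg s) = ev z s.
Proof. by rewrite mmap_map_mpoly. Qed.

Variables (n : nat) (n0 : (0 < n)%N).
Local Notation N := (n + n)%N.

Lemma lshift_or_rshift (i : 'I_N) :
  (exists k, i = lshift n k) \/ (exists k, i = rshift n k).
Proof.
by rewrite -(fintype.splitK i); case: (fintype.split i) => k; [left|right]; exists k.
Qed.

Lemma exp_graphl (x : 'rV[R]_n) k : exp_graph x (lshift n k) = x 0 k.
Proof. by rewrite /exp_graph row_mxEl. Qed.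

Lemma exp_graphr (x : 'rV[R]_n) k : exp_graph x (rshift n k) = expR (x 0 k).
Proof. by rewrite /exp_graph row_mxEr mxE. Qed.

Definition is_left (i : 'I_N) : bool := if fintype.split i is inl _ then true else false.

Lemma is_leftl k : is_left (lshift n k) = true.
Proof. by rewrite /is_left (unsplitK (inl k)). Qed.

Lemma is_leftr k : is_left (rshift n k) = false.
Proof. by rewrite /is_left (unsplitK (inr k)). Qed.

(* [side true] is the set of the variables X, [side false] that of the variables U. *)
Definition side (b : bool) : {set 'I_N} := [set i | is_left i == b].

Lemma card_sideC b : (#|~: side b| <= n)%N.
Proof.
have -> : ~: side b =
    [set (if b then rshift n i else lshift n i) | i in [set: 'I_n]%SET]%SET.
  apply/setP => i; rewrite !inE; case: b; apply/idP/imsetP => [|[k _ ->]];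
    rewrite ?is_leftl ?is_leftr //.
    by have [[k ->]|[k ->]] := lshift_or_rshift i; rewrite ?is_leftl //; exists k.
  by have [[k ->]|[k ->]] := lshift_or_rshift i; rewrite ?is_leftr //; exists k.
by rewrite (leq_trans (leq_imset_card _ _)) // cardsT card_ord.
Qed.

Definition slot (b : bool) (j : 'I_n) : 'I_N := if b then lshift n j else rshift n j.

Lemma card_sideC_del b j : (#|~: (side b :\ slot b j)| <= n.+1)%N.
Proof.
rewrite finset.setCD -[n.+1]addn1 (leq_trans (leq_card_setU _ _).1) //.
by rewrite leq_add ?card_sideC // cards1.
Qed.

Lemma exp_graph_continuous i : continuous (fun x : 'rV[R]_n => exp_graph x i).
Proof.
have [[k ->]|[k ->]] := lshift_or_rshift i.
  by under eq_fun do rewrite exp_graphl; apply: coord_continuous.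
under eq_fun do rewrite exp_graphr.
by move=> x; apply: continuous_comp; [exact: coord_continuous|exact: continuous_expR].
Qed.

Lemma closed_familyW (V : set 'rV[R]_n) :
  closed_family hK.1 (@exp_graph R n) V -> closed V.
Proof.
case=> k [Q ->].
have -> : [set x : 'rV[R]_n | forall i, ev (exp_graph x) (Q i) = 0] =
    \bigcap_(i in [set: 'I_k]) [set x | ev (exp_graph x) (Q i) = 0].
  by apply/seteqP; split=> x h i; [move=> _|]; apply: h.
apply: closed_bigI => i _.
apply: (preimage_closed (f := fun x => ev (exp_graph x) (Q i)) (D := [set x | x = 0])).
  by move=> x _; apply: continuous_mmap; apply: exp_graph_continuous.
exact: closed_eq.
Qed.

Definition mix (D : {set 'I_N}) (w : 'I_N -> R) (x : 'rV[R]_n) (i : 'I_N) : R :=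
  if i \in D then exp_graph x i else w i.

Lemma line_expoly_exp_graph i : line_expoly (fun x : 'rV[R]_n => exp_graph x i).
Proof.
have [[k ->]|[k ->]] := lshift_or_rshift i.
  apply: eq_line_expoly (line_expoly_coord k) => x; by rewrite exp_graphl.
apply: eq_line_expoly (line_expoly_expcoord k) => x; by rewrite exp_graphr.
Qed.

(* A polynomial that does not vanish at w is not killed by replacing some of the
   coordinates of w by those of a generic point (x, exp x). *)
Lemma mix_nonzero_open b (D : {set 'I_N}) (w : 'I_N -> nat) (F : mpoly N Kt)
    (U : set 'rV[R]_n) (wR := fun i => (w i).+1%:R) :
  D \subset side b -> ev wR F != 0 -> open U -> U !=set0 ->
  let W := U `&` [set x | ev (mix D wR x) F != 0] in open W /\ W !=set0.
Proof.
move=> /fintype.subsetP Db Fw oU U0.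
have cF : continuous (fun x => ev (mix D wR x) F).
  apply: (@continuous_mmap R _ N _ _ (fun i x => mix D wR x i)) => i; rewrite /mix.
  by case: (i \in D); [exact: exp_graph_continuous|exact: cst_continuous].
have lF : line_expoly (fun x => ev (mix D wR x) F).
  apply: (@line_expoly_mmap R n N _ _ (fun i x => mix D wR x i)) => i; rewrite /mix.
  by case: (i \in D); [exact: line_expoly_exp_graph|exact: line_expoly_cst].
split.
  apply: openI => //; apply: (open_comp (D := [set y | y != 0])); last exact: open_neq.
  by move=> x _; apply: cF.
apply: contrapT => noW.
(* On side b, the point (x0, e^x0) has the coordinates of w; for the exponential side this takes
   logarithms, defined since w is positive. *)
pose x0 : 'rV[R]_n := \row_k if b then wR (lshift n k) else ln (wR (rshift n k)).
have F0 : ev (mix D wR x0) F = 0.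
  apply: (line_expoly_identity lF oU U0) => x Ux; apply: contrapT => /eqP Fx.
  by apply: noW; exists x.
case/eqP: Fw; rewrite -[RHS]F0; apply: eq_mmap => // i; rewrite /mix.
case: ifP => // /Db; rewrite inE; have [[k ->]|[k ->]] := lshift_or_rshift i.
  by rewrite is_leftl exp_graphl mxE => /eqP <-.
rewrite is_leftr exp_graphr mxE => /eqP <-.
by rewrite lnK // posrE ltr0n.
Qed.

(** If F is nonzero, some independent algebraic x satisfies F(x, w) != 0. By Schanuel's conjecture
    the e^(x_i) are then algebraically independent, so F(x, e^x) = 0 would force F(x, w) = 0. *)
Lemma mpoly_exp_graph_eq0 (F : mpoly N Kt) :
  (forall x : 'rV[R]_n, ev (exp_graph x) F = 0) -> F = 0.
Proof.
move=> F0; apply: contrapT => /eqP Fn0.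
have [w Fw] := mpoly_nonzero_point (f := \val) (@subfield_val_inj _ _ hK.1) Fn0.
have [oW W0] := mix_nonzero_open (D := side true) (subxx _) Fw openT (ex_intro _ 0 I).
have [th [algth freeth]] := exists_algebraic_rat_free R n.
have [x [r [[_ Fx] xr freex]]] := rat_multiple_in_open oW W0 freeth.
case/eqP: Fx.
have algx i : algebraic (x 0 i).
  by rewrite xr; apply: algebraic_mul => //; apply: algebraic_ratr.
rewrite -ev_real_alg; apply: (schanuel_specialize hS (x := x) (D := side true)
    n0 (rat_free_int_free freex) (card_sideC true) _ (y := exp_graph x)) => //.
- move=> i; rewrite inE; have [[k ->]|[k ->]] := lshift_or_rshift i.
    by rewrite exp_graphl.
  by rewrite is_leftr.
- move=> i; rewrite inE; have [[k ->]|[k ->]] := lshift_or_rshift i.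
    by rewrite exp_graphl.
  by rewrite is_leftr.
- by rewrite ev_real_alg.
- by move=> i iD; rewrite /mix iD.
Qed.

(** * Fibres of a component along the j-th axis *)

Section Component.
Variables (C : set 'rV[R]_n) (s : 'I_N -> mpoly N.-1 Kt) (w : 'I_N -> nat).
Hypothesis cC : closed_family hK.1 (@exp_graph R n) C.
Hypothesis sC : forall k x, C x -> ev (exp_graph x \o lift k) (s k) = 0.
Local Notation wR := (fun i => (w i).+1%:R : R).
Local Notation S := (\prod_k mpoly_rename k (s k)).
Hypothesis sw : ev wR S != 0.
Variable j : 'I_n.
Local Notation uj := (rshift n j).

(* The polynomial [s uj] does not involve the variable e^(X_j); freezing the other
   exponentials at w leaves a polynomial relation between the coordinates of z. *)
Definition rho (z : 'rV[R]_n) : R :=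
  ev (mix (side true) wR z \o lift uj) (s uj).

Lemma exp_graph_replace_coord (x : 'rV[R]_n) t i : i != lshift n j -> i != uj ->
  exp_graph (replace_coord j x t) i = exp_graph x i.
Proof.
have [[k ->]|[k ->]] := lshift_or_rshift i.
  by rewrite (inj_eq (@lshift_inj _ _)) !exp_graphl => kj _; rewrite replace_coordN.
by rewrite (inj_eq (@rshift_inj _ _)) !exp_graphr => _ kj; rewrite replace_coordN.
Qed.

Lemma lin_algebraic q (x : 'rV[R]_n) : (forall i, algebraic (x 0 i)) ->
  algebraic (lin j q x).
Proof.
move=> algx; apply: big_ind => [||i _]; [exact: algebraic0|exact: algebraic_add|].
by apply: algebraic_mul => //; exact: algebraic_ratr.
Qed.

(** On side b without its j-th slot, the coordinates are algebraic and do not depend on t. This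
    leaves n + 1 coordinates, as many as [schanuel_relation] allows, and the resulting dependence
    can be solved for t. Algebraic x_i use b = true, logarithms b = false. *)
Lemma fiber_relation b (x : 'rV[R]_n) t :
  rat_free (x 0) -> C (replace_coord j x t) ->
  (forall i, i \in side b :\ slot b j -> algebraic (exp_graph x i)) ->
  ev (mix (side b :\ slot b j) wR x) S != 0 ->
  exists q, t = lin j q x.
Proof.
move=> freex Cz algD mixS.
have kD i : i \in side b :\ slot b j -> exp_graph (replace_coord j x t) i = exp_graph x i.
  clear algD mixS; rewrite !inE /slot; have [[l ->]|[l ->]] := lshift_or_rshift i;
    rewrite ?is_leftl ?is_leftr; case: b; rewrite ?andbF ?andbT //= => lk;
    by apply: exp_graph_replace_coord; rewrite ?eq_lrshift ?eq_rlshift.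
have [] := @schanuel_relation R hS n (replace_coord j x t) (side b :\ slot b j)
  (fun k => map_mpoly to_real_alg (s k)) (mix (side b :\ slot b j) wR x) n0.
- exact: card_sideC_del.
- by move=> i iD; rewrite kD //; apply: algD.
- by move=> l; rewrite ev_real_alg; apply: sC.
- by move=> i iD; rewrite kD // /mix iD.
- move=> l; rewrite ev_real_alg -mmap_rename.
  by move: mixS; rewrite rmorph_prod => /prodf_neq0; apply.
by move=> m [m0 mz]; apply: (relation_lin freex m0 mz).
Qed.

(** Here t is a rational combination of algebraic numbers, hence algebraic, while the e^(x_i) are
    independent: the relation free of U_j survives the replacement of the exponentials by w. *)
Lemma fiber_root_algebraic (x : 'rV[R]_n) t : (forall i, algebraic (x 0 i)) ->
  rat_free (x 0) -> C (replace_coord j x t) ->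
  ev (mix (side true :\ lshift n j) wR x) S != 0 ->
  rho (replace_coord j x t) = 0.
Proof.
move=> algx freex Cz mixS.
have algl i : i \in side true -> algebraic (exp_graph x i).
  rewrite inE; have [[k ->]|[k ->]] := lshift_or_rshift i.
    by rewrite exp_graphl.
  by rewrite is_leftr.
have [q tq] : exists q, t = lin j q x.
  apply: (@fiber_relation true) => // i /setD1P[_]; exact: algl.
rewrite /rho -ev_real_alg -mmap_rename.
(* The slot of U_j keeps e^(x_j) rather than e^t, so that the exponentials are those of the
   independent x; [s uj] does not see this slot. *)
apply: (schanuel_specialize hS (x := x) (D := side true) n0
  (rat_free_int_free freex) (card_sideC true) algl
  (y := fun i => if i == lshift n j then t else exp_graph x i)).
- by move=> i; case: eqP => // ->; rewrite inE is_leftl.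
- move=> i iD; case: eqP => _; last exact: algl.
  by rewrite tq; apply: lin_algebraic.
- rewrite mmap_rename -[RHS](sC uj Cz) -ev_real_alg; apply: eq_mmap => // i /=.
  case: eqP => [->|/eqP ij]; first by rewrite exp_graphl replace_coordE.
  by rewrite exp_graph_replace_coord // eq_sym neq_lift.
- move=> i iD; rewrite /mix iD; case: eqP => [->|/eqP ij].
    by rewrite exp_graphl replace_coordE.
  rewrite exp_graph_replace_coord //.
  by apply: contraTneq iD => ->; rewrite inE is_leftr.
Qed.

(** The roles are exchanged: the e^(x_i) are algebraic and the x_i algebraically independent, so
    substituting t = q.x' in [rho] gives a relation that holds identically in x'. *)
Lemma fiber_root_log (x : 'rV[R]_n) t : (forall i, algebraic (expR (x 0 i))) ->
  rat_free (x 0) -> C (replace_coord j x t) -> rho (replace_coord j x t) = 0 ->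
  ev (mix (side false :\ uj) wR x) S != 0 ->
  exists2 q, t = lin j q x & forall X, rho (replace_coord j X (lin j q X)) = 0.
Proof.
move=> algx freex Cz rz mixS.
have algr i : i \in side false -> algebraic (exp_graph x i).
  rewrite inE; have [[k ->]|[k ->]] := lshift_or_rshift i.
    by rewrite is_leftl.
  by rewrite exp_graphr.
have [q tq] : exists q, t = lin j q x.
  apply: (@fiber_relation false) => // i /setD1P[_]; exact: algr.
exists q => // X.
pose ratA (a : rat) : real_alg R := insubd 0 (ratr a).
(* The linear form q.X' is substituted for the variable X_j. *)
pose h (i : 'I_N) : mpoly N (real_alg R) := if i == lshift n j
  then \sum_(k < n | k != j) mpolyC N (ratA (q k)) * mvar (lshift n k)
  else mvar i.
pose p := mmap (@mpolyC N _) h (mpoly_rename uj (map_mpoly to_real_alg (s uj))).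
have pE z : evA (mix (side true) wR z) p = rho (replace_coord j z (lin j q z)).
  rewrite /rho -ev_real_alg -mmap_rename mmap_comp; apply: eq_mmap => // i.
  rewrite /h /mix; case: eqP => [->|/eqP ij]; last first.
    rewrite mmapXU; case: ifP => // iD; rewrite exp_graph_replace_coord //.
    by apply: contraTneq iD => ->; rewrite inE is_leftr.
  rewrite inE is_leftl exp_graphl replace_coordE mmap_linear_form.
  apply: eq_bigr => k kj; rewrite inE is_leftl exp_graphl.
  by rewrite /= real_algE //; apply: algebraic_ratr.
rewrite -pE; apply: (schanuel_specialize hS (x := x) (D := side false) n0
  (rat_free_int_free freex) (card_sideC false) algr
  (y := mix (side true) wR x)).
- move=> i; rewrite inE /mix inE; by case: (is_left i).
- move=> i; rewrite inE /mix inE => /eqP -> /=; exact: algebraic_nat.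
- by rewrite pE -tq.
- by move=> i; rewrite inE /mix !inE => /eqP ->.
Qed.

Lemma rat_free_lin_inj (x : 'rV[R]_n) q q' : rat_free (x 0) ->
  lin j q x = lin j q' x -> forall z : 'rV[R]_n, lin j q z = lin j q' z.
Proof.
move=> freex qq' z; apply: eq_bigr => i ij; congr (ratr _ * _); apply/eqP.
rewrite -subr_eq0; apply/eqP.
have := freex (fun i => if i == j then 0 else q i - q' i) _ i.
rewrite (negPf ij); apply; rewrite (bigD1 j) //= eqxx rmorph0 mul0r add0r.
have /eqP := qq'; rewrite -subr_eq0 /lin -sumrB => /eqP d0.
by rewrite -[RHS]d0; apply: eq_bigr => k /negPf ->; rewrite rmorphB mulrBl.
Qed.

(** At an independent x with [rho x] nonzero, [rho] is a nonzero polynomial in the j-th coordinate.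
    Each admissible q gives a root q.x', and independence of x recovers from it the linear form. *)
Lemma finitely_many_slopes : exists qs : seq {ffun 'I_n -> rat},
  forall q, (forall X, rho (replace_coord j X (lin j q X)) = 0) ->
  exists2 q' : {ffun 'I_n -> rat}, q' \in qs &
    forall x : 'rV[R]_n, lin j q x = lin j q' x.
Proof.
pose F := mpoly_rename uj (s uj).
have Fw : ev wR F != 0.
  by move: sw; rewrite rmorph_prod => /prodf_neq0; apply.
have [oW W0] := mix_nonzero_open (D := side true) (subxx _) Fw openT (ex_intro _ 0 I).
have [th [_ freeth]] := exists_algebraic_rat_free R n.
have [x [r [[_ Fx] _ freex]]] := rat_multiple_in_open oW W0 freeth.
pose p := map_poly (ev (mix (side true) wR x \o lift (lshift n j)))
  (poly_of_mpoly (lshift n j) F).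
have pE t : p.[t] = rho (replace_coord j x t).
  rewrite /rho -mmap_rename -(horner_poly_of_mpoly (lshift n j)) /p.
  rewrite {3}/mix inE is_leftl exp_graphl replace_coordE /=.
  congr horner; apply: eq_map_poly => c; apply: eq_mmap => // i /=; rewrite /mix.
  case: ifP => // iD; rewrite exp_graph_replace_coord //.
    by rewrite eq_sym neq_lift.
  by apply: contraTneq iD => ->; rewrite inE is_leftr.
have p0 : p != 0.
  apply: contraNneq Fx => p0; rewrite mmap_rename -/(rho x).
  by rewrite -(replace_coord_id j x) -pE p0 horner0.
have [rs hrs] := poly_roots_seq p0.
(* One slope is chosen for each root; 0 is the default at roots not of the form q.x'. *)
exists [seq xget [ffun=> 0] [set q : {ffun 'I_n -> rat} | lin j q x = z] | z <- rs].
move=> q hq; set Q := fun z => xget _ _.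
exists (Q (lin j q x)).
  by apply/map_f/hrs; rewrite /root pE hq.
have : lin j (Q (lin j q x)) x = lin j q x.
  rewrite /Q; case: xgetP => [q' _ //|/(_ [ffun i => q i]) []].
  by rewrite /= /lin; apply: eq_bigr => i _; rewrite ffunE.
by move=> /esym; apply: rat_free_lin_inj.
Qed.

Lemma mix_continuous D v i : continuous (fun x => mix D v x i).
Proof.
rewrite /mix; case: (i \in D); first exact: exp_graph_continuous.
exact: cst_continuous.
Qed.

Lemma rho_continuous : continuous rho.
Proof.
apply: (@continuous_mmap R _ _ _ _ (fun i x => mix (side true) wR x (lift uj i))).
by move=> i; apply: mix_continuous.
Qed.

Variables (a b : R) (U : set 'rV[R]_n).
Hypotheses (oU : open U) (U0 : U !=set0).
Hypothesis fib : forall x, U x -> exists2 t, a <= t <= b & C (replace_coord j x t).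

(** Otherwise, by compactness of [a, b], no point of C above any y near x would be a zero of [rho].
    Among these y there are algebraic ones, to which [fiber_root_algebraic] applies. *)
Lemma fiber_root x : U x ->
  exists2 t, a <= t <= b & C (replace_coord j x t) /\ rho (replace_coord j x t) = 0.
Proof.
move=> Ux; apply: contrapT => nox.
pose G := C `&` [set z | rho z = 0].
have cG : closed G.
  apply: closedI; first exact: closed_familyW.
  apply: (preimage_closed (D := [set y | y = 0])); last exact: closed_eq.
  by move=> z _; apply: rho_continuous.
have Gx : \forall y \near x, `[a, b] `<=` (fun t => ~ G (replace_coord j y t)).
  apply: ((compact_near_coveringP _).1 (@segment_compact R a b) _ (nbhs x)
    (fun y t => ~ G (replace_coord j y t))) => t.
  rewrite /= in_itv /= => tab.
  have nG : (~` G) (replace_coord j x t) by move=> [Cz rz]; apply: nox; exists t.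
  have oG : open (~` G) by exact: closed_openC.
  have nbG : nbhs (replace_coord j x t) (~` G) by apply: open_nbhs_nbhs.
  have [[A B] /= [Ax Bt] AB] := @replace_coord_continuous R n j (x, t) _ nbG.
  by exists (B, A) => //= -[t' y] /= [Bt' Ay]; apply: (AB (y, t')).
pose V := interior [set y | `[a, b] `<=` (fun t => ~ G (replace_coord j y t))] `&` U.
have oV : open V by apply: openI => //; exact: open_interior.
have V0 : V !=set0 by exists x.
have [oW W0] := mix_nonzero_open (finset.subsetDl (side true) [set lshift n j]) sw oV V0.
have [th [algth freeth]] := exists_algebraic_rat_free R n.
have [y [r [[[yG Uy] Sy] yr freey]]] := rat_multiple_in_open oW W0 freeth.
have [t tab Cy] := fib Uy.
have /= := interior_subset yG; move=> /(_ t); rewrite /= in_itv /= tab => /(_ isT).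
apply; split=> //; apply: fiber_root_algebraic => // i.
by rewrite yr; apply: algebraic_mul => //; apply: algebraic_ratr.
Qed.

Lemma lin_sum q (x : 'rV[R]_n) :
  \sum_k (if k == j then 0 else ratr (q k)) * x 0 k = lin j q x.
Proof.
by rewrite (bigD1 j) //= eqxx mul0r add0r; apply: eq_bigr => k /negPf ->.
Qed.

Lemma lin_continuous q : continuous (@lin R n j q).
Proof.
have -> : @lin R n j q =
    fun x => \sum_k (if k == j then 0 else ratr (q k)) * x 0 k.
  by apply/funext => x; rewrite lin_sum.
apply: continuous_bigsum => k; apply: continuous_scale; exact: coord_continuous.
Qed.

(* At the points with logarithmic coordinates only finitely many slopes occur, and
   these points are dense, so one slope works on a whole open set. *)
Lemma linear_section : exists (q : 'I_n -> rat) (W : set 'rV[R]_n),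
  [/\ open W, W !=set0 & forall x, W x -> C (replace_coord j x (lin j q x))].
Proof.
have [qs hqs] := finitely_many_slopes.
pose B (q : {ffun 'I_n -> rat}) := [set x | C (replace_coord j x (lin j q x))].
have cB q : closed (B q).
  apply: (preimage_closed (f := fun x => replace_coord j x (lin j q x)) (D := C)).
    move=> x _ A nbA.
    have [[V V'] /= [Vx V'x] VA] := @replace_coord_continuous R n j (x, lin j q x) _ nbA.
    apply: filterS (filterI Vx (lin_continuous V'x)) => y [Vy V'y].
    exact: (VA (y, lin j q y)).
  exact: closed_familyW.
have [|q [W [oW W0 WB]]] := @finite_closed_cover _ _ qs B U cB oU U0; last first.
  by exists q, W.
move=> W oW W0 WU.
have [oV V0] := mix_nonzero_open (finset.subsetDl (side false) [set uj]) sw oW W0.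
have [th [algth freeth]] := exists_log_rat_free R n.
have [x [r [[Wx Sx] xr freex]]] := rat_multiple_in_open oV V0 freeth.
have [t tab [Cx rx]] := fiber_root (WU x Wx).
have [|q tq rq] := fiber_root_log _ freex Cx rx Sx.
  by move=> i; rewrite xr; apply: algth.
have [q' q's qq'] := hqs q rq; exists x => //; exists q' => //.
by rewrite /B /= -qq' -tq.
Qed.

Lemma exp_graph_lin_expoly q i :
  line_expoly (fun x : 'rV[R]_n => exp_graph (replace_coord j x (lin j q x)) i).
Proof.
have [[k ->]|[k ->]] := lshift_or_rshift i; have [->|kj] := eqVneq k j.
- apply: eq_line_expoly (line_expoly_linear (fun k => if k == j then 0 else ratr (q k))).
  by move=> x; rewrite exp_graphl replace_coordE lin_sum.
- apply: eq_line_expoly (line_expoly_coord k) => x.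
  by rewrite exp_graphl replace_coordN.
- apply: eq_line_expoly (line_expoly_exp (fun k => if k == j then 0 else ratr (q k))).
  by move=> x; rewrite exp_graphr replace_coordE lin_sum.
- apply: eq_line_expoly (line_expoly_expcoord k) => x.
  by rewrite exp_graphr replace_coordN.
Qed.

(** On the hyperplane, e^(X_j) is the exponential of a linear form in x', so the identity theorem
    applies to every F vanishing on C. *)
Lemma hyperplane_sub q W : open W -> W !=set0 ->
  (forall x, W x -> C (replace_coord j x (lin j q x))) ->
  forall x, C (replace_coord j x (lin j q x)).
Proof.
move=> oW W0 WC x; apply: (closed_vanishing cC) => F CF.
apply: (line_expoly_identity (f := fun x => ev (exp_graph
  (replace_coord j x (lin j q x))) F) _ oW W0) => [|y /WC Cy]; last exact: CF.
apply: (@line_expoly_mmap R n N _ _ (fun i x => exp_graph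
  (replace_coord j x (lin j q x)) i)) => i.
exact: exp_graph_lin_expoly.
Qed.

Lemma ratr_subfield (r : rat) : \val (insubd 0 (ratr r) : Kt) = ratr r.
Proof. by rewrite insubdK // /ratr rpred_div // rpred_int. Qed.

Lemma sub_hyperplane q : prime_ideal (vanishing (hK := hK.1) (@exp_graph R n) C) ->
  (forall x, C (replace_coord j x (lin j q x))) ->
  forall x, C x -> x 0 j = lin j q x.
Proof.
move=> primeC HC.
pose H := [set x : 'rV[R]_n | x 0 j = lin j q x].
(* [kap k] is the index of X_k once U_j has been removed. *)
have /choice[kap kapE] : forall k, exists l : 'I_N.-1, lift uj l = lshift n k.
  move=> k.
  case: (unliftP uj (lshift n k)) => [l ->|/eqP]; first by exists l.
  by rewrite eq_lrshift.
pose L : mpoly N.-1 Kt := mvar (kap j) -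
  \sum_(i < n | i != j) mpolyC N.-1 (insubd 0 (ratr (q i)) : Kt) * mvar (kap i).
have LE z : ev (exp_graph z) (mpoly_rename uj L) = z 0 j - lin j q z.
  rewrite mmap_rename mmap_sub mmapXU mmap_linear_form /= kapE exp_graphl.
  congr (_ - _); apply: eq_bigr => i _.
  by rewrite /= kapE exp_graphl ratr_subfield.
have HCs x : H x -> C x by move=> Hx; rewrite -[x](replace_coord_id j) Hx.
(* The source consists of the polynomials in X_j whose coefficients involve neither X_j nor U_j. *)
pose phi : {rmorphism {poly mpoly N.-1.-1 Kt} -> mpoly N Kt} :=
  @mpoly_rename Kt N uj \o @mpoly_of_poly Kt N.-1 (kap j).
have phiK F : phi (poly_of_mpoly (kap j) F) = mpoly_rename uj F.
  by rewrite /phi /= poly_of_mpolyK.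
have phiC c : phi c%:P = mpoly_rename uj (mpoly_rename (kap j) c).
  by rewrite /phi /= mpoly_of_polyC.
suff : vanishing (hK := hK.1) (@exp_graph R n) C (phi (poly_of_mpoly (kap j) L)).
  by rewrite phiK => CL x /CL /eqP; rewrite LE subr_eq0 => /eqP.
apply: (@prime_ideal_poly_eq _ (vanishing (hK := hK.1) (@exp_graph R n) H \o phi)
  (vanishing (hK := hK.1) (@exp_graph R n) C \o phi)).
- exact/ideal_preim/vanishing_ideal.
- exact: prime_ideal_preim.
- by move=> p hp x /HCs; apply: hp.
(* Changing only the j-th coordinate moves any x into H without affecting c, so c vanishes at every
   (x, e^x). *)
- move=> c hc; apply: (@mpoly_rename_inj _ _ (kap j)).
  apply: (@mpoly_rename_inj _ _ uj); rewrite !rmorph0 -phiC.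
  apply: mpoly_exp_graph_eq0 => x.
  have Hx : H (replace_coord j x (lin j q x)).
    by rewrite /H /= replace_coordE lin_replace_coord.
  have := hc _ Hx; rewrite phiC !mmap_rename => hcx.
  rewrite -[RHS]hcx; apply: eq_mmap => // i /=; rewrite exp_graph_replace_coord //.
    by rewrite -kapE (inj_eq lift_inj) eq_sym neq_lift.
  by rewrite eq_sym neq_lift.
(* The relation free of U_j is the nonzero element of the smaller ideal. *)
- exists (poly_of_mpoly (kap j) (s uj)).
    apply: contraNneq sw => s0.
    have suj0 : s uj = 0 by rewrite -(poly_of_mpolyK (kap j) (s uj)) s0 rmorph0.
    have S0 : S = 0 by rewrite (bigD1 uj) //= suj0 rmorph0 mul0r.
    by rewrite S0 rmorph0.
  by rewrite /comp phiK => x Cx; rewrite mmap_rename sC.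
- by rewrite /comp phiK => x Hx; rewrite LE; apply/eqP; rewrite subr_eq0; apply/eqP.
Qed.

Lemma component_rational_hyperplane :
  prime_ideal (vanishing (hK := hK.1) (@exp_graph R n) C) -> rational_hyperplane C.
Proof.
move=> primeC; have [q [W [oW W0 WC]]] := linear_section.
have HC := hyperplane_sub oW W0 WC; have CH := sub_hyperplane primeC HC.
exists (fun i => if i == j then -1 else q i); split.
  by exists j; rewrite eqxx oppr_eq0 oner_eq0.
have E (x : 'rV[R]_n) :
    \sum_(i < n) ratr (if i == j then -1 else q i) * x 0 i = lin j q x - x 0 j.
  rewrite (bigD1 j) //= eqxx rmorphN rmorph1 mulN1r addrC; congr (_ - _).
  by apply: eq_bigr => i /negPf ->.
apply/seteqP; split=> x /=; rewrite E; first by move=> /CH ->; rewrite subrr.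
by move=> /eqP; rewrite subr_eq0 => /eqP xj; rewrite -[x](replace_coord_id j) -xj.
Qed.

End Component.

(** If F vanishes on A but not identically, then G vanishing on B is zero on the nonempty open set
    where F is not, hence everywhere. This excludes P = 0 below. *)
Lemma irreducible_setT : irreducible_set (closed_family hK.1 (@exp_graph R n)) setT.
Proof.
have lF F : line_expoly (fun x : 'rV[R]_n => ev (exp_graph x) F).
  apply: (@line_expoly_mmap R n N _ _ (fun i x => exp_graph x i)) => i.
  exact: line_expoly_exp_graph.
have cF F : continuous (fun x : 'rV[R]_n => ev (exp_graph x) F).
  apply: (@continuous_mmap R _ N _ _ (fun i x => exp_graph x i)) => i.
  exact: exp_graph_continuous.
split; [|by exists 0|].
  exists 0%N, (fun=> 0); apply/seteqP; split=> // x _ [] //.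
case=> A [B [cA cB [_ nA] [_ nB] AB]].
have proper V : closed_family hK.1 (@exp_graph R n) V -> ~ setT `<=` V ->
    exists F x, vanishing (hK := hK.1) (@exp_graph R n) V F /\ ev (exp_graph x) F != 0.
  move=> cV nV; apply: contrapT => nF; apply: nV => x _.
  apply: (closed_vanishing cV) => F VF; apply: contrapT => /eqP Fx.
  by apply: nF; exists F, x.
have [F [x [AF Fx]]] := proper A cA nA; have [G [y [BG Gy]]] := proper B cB nB.
case/eqP: Gy; apply: (line_expoly_identity (lF G)
  (O := [set z | ev (exp_graph z) F != 0])).
- by apply: (open_comp (D := [set z | z != 0])); [move=> z _; apply: cF|exact: open_neq].
- by exists x.
move=> z /eqP Fz; apply: BG.
have : (A `|` B) z by rewrite -AB.
by case=> // /AF.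
Qed.

End Hyperplane.

Theorem theorem1p1 (R : realType) (K : {pred R})
    (hK : real_algebraic_extension K)
    (hSchanuel : Schanuel_conjecture R)
    (n : nat) (hn : (1 <= n)%N)
    (P : mpoly.mpoly (n + n) R) (hPK : poly_over K P)
    (hPirr : irreducible_set (algebraic_set K (m := n + n)) (Zer1 (peval P)))
    (hdim : has_dim K (Zer1 (E P)) (n - 1)) :
  irreducible_set (exponential_set K (n := n)) (Zer1 (E P)) \/
  (forall C : set 'rV[R]_n,
     irreducible_component K (Zer1 (E P)) C ->
     has_dim K C (n - 1) ->
     rational_hyperplane C).
Proof.
have [irrV|redV] := EM (irreducible_set (exponential_set K (n := n)) (Zer1 (E P))).
  by left.
right=> C compC dimC.
have [Q PQ] := (poly_over_subfield hK.1 P).1 hPK.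
have algZ : Zer1 (peval P) = [set x : 'rV[R]_(n + n) |
    mmap (\val : subfield hK.1 -> R) (x 0) Q = 0].
  by apply/seteqP; split=> x; rewrite /Zer1 /= /peval PQ meval_map_mpoly.
have expZ : Zer1 (E P) = [set x : 'rV[R]_n |
    mmap (\val : subfield hK.1 -> R) (exp_graph x) Q = 0].
  by apply/seteqP; split=> x; rewrite /Zer1 /= /E /peval PQ meval_map_mpoly.
have CV := component_sub compC; have irrC := component_irreducible compC.
move: hPirr redV irrC CV; rewrite algZ expZ (algebraic_setE hK.1) (exponential_setE hK.1).
move=> irrW redV irrC CV.
have Q0 : Q != 0.
  apply/negP => /eqP Q0; apply: redV; rewrite Q0.
  have -> : [set x : 'rV[R]_n | mmap (\val : subfield hK.1 -> R) (exp_graph x) 0 = 0]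
      = setT by apply/seteqP; split=> // x _; exact: rmorph0.
  exact: irreducible_setT.
have [VC|relC] := irreducible_dichotomy Q0 irrW irrC CV.
  by case: redV; rewrite -VC.
have /choice[s hs] : forall k, exists s : mpoly (n + n).-1 (subfield hK.1),
    s != 0 /\ forall x, C x -> mmap (\val : subfield hK.1 -> R)
      (exp_graph x \o lift k) s = 0.
  by move=> k; have [s] := relC k; exists s.
(* Taking the product of the relations gives one point w at which none of them vanishes. *)
have S0 : \prod_k mpoly_rename k (s k) != 0.
  apply/prodf_neq0 => k _; apply: contraNneq (hs k).1 => sk0.
  by apply/eqP; apply: (@mpoly_rename_inj _ _ k); rewrite sk0 rmorph0.
have [w Sw] := mpoly_nonzero_point (f := \val) (@subfield_val_inj _ _ hK.1) S0.
have primeC := irreducible_vanishing irrC.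
case: irrC => cC _ _.
have [j [a [b [U [oU U0 fib]]]]] : exists j a b (U : set 'rV[R]_n),
    [/\ open U, U !=set0 & forall x, U x -> exists2 t, a <= t <= b &
      C (replace_coord j x t)].
  move: hn dimC; clear; case: n C => // m C _; rewrite subn1 /=.
  exact: has_dim_section.
exact: (component_rational_hyperplane hSchanuel hn cC (fun k => (hs k).2) Sw
  oU U0 fib primeC).
Qed.
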